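(* For any Noetherian local ring $(R,\mathfrak m)$ of dimension two and any $\mathfrak m$-primary $\mathfrak m$-full ideal $I$ which can be generated by $N$ elements, we have \[\operatorname{e}(I)\le 2\left(1-\frac{1}{2N-2}\right)\operatorname{e}(R)\,\ell(R/I).\]
   Context: Let $\mathfrak m=(x_1,\dots,x_n)$, $\widetilde R=R(t_1,\dots,t_n)=R[t_1,\dots,t_n]_{\mathfrak mR[t_1,\dots,t_n]}$, and $z=t_1x_1+\cdots+t_nx_n$. An ideal $I$ is $\mathfrak m$-full if $\mathfrak m I\widetilde R:_{\widetilde R} z=I\widetilde R$. $\operatorname{e}$ denotes Hilbert--Samuel multiplicity, $\operatorname{e}(R)=\operatorname{e}(\mathfrak m)$. (An $\mathfrak m$-primary ideal in a two-dimensional local ring needs at least two generators, so $N\ge2$.) *)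

(* Defs.v *)
From HB Require Import structures.
From mathcomp Require Import all_boot all_order all_algebra.
From mathcomp Require Import mpoly.
Set Implicit Arguments. Unset Strict Implicit. Unset Printing Implicit Defensive.
Import Order.TTheory GRing.Theory Num.Theory.
Local Open Scope ring_scope.

Section CommAlg.
Variable R : comNzRingType.

Definition subsetR (A B : R -> Prop) := forall r, A r -> B r.
Definition eqsetR (A B : R -> Prop) := forall r, A r <-> B r.
Definition ssubsetR (A B : R -> Prop) := subsetR A B /\ ~ subsetR B A.

Definition is_ideal (J : R -> Prop) :=
  [/\ J 0, (forall a b, J a -> J b -> J (a + b)) & (forall r a, J a -> J (r * a))].

Definition proper (J : R -> Prop) := is_ideal J /\ ~ J 1.

Definition gen_ideal (k : nat) (y : 'I_k -> R) : R -> Prop :=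
  fun r => exists c : 'I_k -> R, r = \sum_(i < k) c i * y i.

Definition noetherian := forall J, is_ideal J ->
  exists k (y : 'I_k -> R), eqsetR J (gen_ideal y).

Definition is_maximal (M : R -> Prop) :=
  proper M /\ forall J, is_ideal J -> subsetR M J -> eqsetR J M \/ J 1.

Definition local_with_max (M : R -> Prop) :=
  is_maximal M /\ forall J, is_maximal J -> eqsetR J M.

Definition is_prime (P : R -> Prop) :=
  proper P /\ forall a b, P (a * b) -> P a \/ P b.

Definition prime_chain (k : nat) (P : nat -> R -> Prop) :=
  (forall i, (i <= k)%N -> is_prime (P i)) /\
  (forall i, (i < k)%N -> ssubsetR (P i) (P i.+1)).

Definition krull_dim_eq (d : nat) :=
  (exists P, prime_chain d P) /\ (forall k P, prime_chain k P -> (k <= d)%N).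

Definition ideal_mul (J K : R -> Prop) : R -> Prop :=
  fun r => exists k (a b : 'I_k -> R),
    (forall i, J (a i)) /\ (forall i, K (b i)) /\ r = \sum_(i < k) a i * b i.

Definition whole : R -> Prop := fun _ => True.

Fixpoint ideal_pow (J : R -> Prop) (n : nat) : R -> Prop :=
  match n with 0 => whole | n'.+1 => ideal_mul J (ideal_pow J n') end.

Definition radical (J : R -> Prop) : R -> Prop := fun r => exists k, J (r ^+ k).

Definition primary_to (M J : R -> Prop) := proper J /\ eqsetR (radical J) M.

(* Length of the R-module R/J is l: chains of submodules of R/J correspond
   to chains of ideals containing J; l is the maximal length of a strictly
   increasing chain of ideals J = J_0 < J_1 < ... < J_l = R. *)
Definition ideal_chain (J : R -> Prop) (k : nat) (C : nat -> R -> Prop) :=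
  (forall i, (i <= k)%N -> is_ideal (C i)) /\ subsetR J (C 0%N) /\
  (forall i, (i < k)%N -> ssubsetR (C i) (C i.+1)).

Definition length_quot (J : R -> Prop) (l : nat) :=
  (exists C, ideal_chain J l C /\ eqsetR (C 0%N) J /\ eqsetR (C l) whole) /\
  (forall k C, ideal_chain J k C -> (k <= l)%N).

(* Hilbert-Samuel multiplicity in dimension 2: e is the multiplicity of J
   iff l(R/J^n) agrees, for all large n, with a polynomial e/2 n^2 + a n + b
   (leading coefficient e / 2!). *)
Definition multiplicity2 (J : R -> Prop) (e : nat) :=
  exists (L : nat -> nat) (a b : rat) (n0 : nat),
    (forall n, length_quot (ideal_pow J n) (L n)) /\
    (forall n, (n0 <= n)%N ->
       (L n)%:R = (e%:R / 2%:R) * (n%:R) ^+ 2 + a * n%:R + b :> rat).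

(* R[t_1..t_n]: multivariate polynomials.  J R[t] = polynomials with all
   coefficients in J. *)
Definition ext_poly (n : nat) (J : R -> Prop) : {mpoly R[n]} -> Prop :=
  fun p => forall mo, J (p@_mo).

Definition zgen (n : nat) (x : 'I_n -> R) : {mpoly R[n]} :=
  \sum_(i < n) (x i)%:MP * 'X_i.

(* Elements of R~ = R[t]_{M R[t]} are fractions f/g with g outside the
   prime M R[t].  A fraction f/g lies in the extended ideal J R~ iff
   s f lies in J R[t] for some s outside M R[t] (g is a unit of R~). *)
Definition in_ext_loc (n : nat) (M J : R -> Prop) (f : {mpoly R[n]}) :=
  exists s : {mpoly R[n]}, ~ ext_poly M s /\ ext_poly J (s * f).

(* I is M-full (w.r.t. the generators x of M):  M I R~ :_{R~} z = I R~.
   Since every g outside M R[t] is a unit of R~, f/g lies in an extended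
   ideal iff f/1 does; so it suffices to range over f in R[t]:
   (z f in M I R~)  <->  (f in I R~). *)
Definition m_full (n : nat) (x : 'I_n -> R) (I : R -> Prop) :=
  let M := gen_ideal x in
  forall f : {mpoly R[n]},
    in_ext_loc M (ideal_mul M I) (zgen x * f) <-> in_ext_loc M I f.

End CommAlg.

(* Main.v *)
Require Import Defs.
From HB Require Import structures.
From Stdlib Require Import Classical ClassicalEpsilon.
From mathcomp Require Import all_boot all_order all_algebra.
From mathcomp Require Import mpoly ring zify lra.
Set Implicit Arguments. Unset Strict Implicit. Unset Printing Implicit Defensive.
Import Order.TTheory GRing.Theory Num.Theory.
Local Open Scope ring_scope.

(** What is gained over Lech's bound [e(I) <= 2 e(R) l(R/I)] is the term [e(R) r]. Each rectangle of
    the staircase is replaced by a trapezoid, and the lost triangles telescope to half of the first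
    column, of height [r]. The factor [1 - 1/(2N-2)] then restates [r >= l(R/I)/(N-1)]. The polygon
    is legitimate because multiplicity sees only large powers: a product of [t] copies of one
    monomial and [N - t] of its neighbour lands on the segment joining them. A generic [z] is taken
    because a finite residue field may admit no superficial element. If [z f] has too high an order,
    the coefficients of [f] are torsion in [gr_m R]; noetherianity of the Rees algebra confines this
    torsion to bounded degrees. The strict bound [l_0 < N] comes from growth: equality would put [I]
    in [m^k + z] for every [k], whose colength grows like [e(R) k]. Hence the separate case
    [e(R) = 0]. Neither [A_P] nor [A_P/z] is constructed: ideals of [A] are compared up to
    multipliers outside [P], and ideals of the quotient are ideals containing [z]. *)

(* Pass to A_P with A = R[t_1..t_n] and P = m A.  Multiplication by the generic
   linear form z gives colen J = colen (J + z) + colen (J : z), so colen I is the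
   sum of the colengths l_k of the images in S = A_P/z of (I : z^k), k < r, where
   r is least with z^r in I.  Since an ideal of colength l contains m^l, powers of
   I contain, in the initial sense, the monomials z^k m^(l_k) and all their
   products; as z is superficial, S/m^a has colength at most e(R) a + O(1), and
   counting the monomials left out of I^N, under the dilated polygon through the
   conjugate staircase of the l_k, yields e(I) <= e(R) (2 colen I - r).  Here
   colen I <= r l_0, and m-fullness gives
   colen (mI + z) = colen (mI) - colen (I) <= N, hence l_0 <= N - 1.
   If e(R) = 0 the same estimate gives e(I) = 0. *)

(** * Colength in a localization *)

Section Ideals.
Variable A : comNzRingType.
Implicit Types J K : A -> Prop.

Definition idealD J K : A -> Prop :=
  fun a => exists b c, [/\ J b, K c & a = b + c].
Definition idealI J K : A -> Prop := fun a => J a /\ K a.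
Definition principal (z : A) : A -> Prop := fun a => exists b, a = b * z.
Definition colon J (z : A) : A -> Prop := fun a => J (z * a).

Lemma ideal0 J : is_ideal J -> J 0. Proof. by case. Qed.
Lemma ideal_add J a b : is_ideal J -> J a -> J b -> J (a + b).
Proof. by case=> _ H _; apply: H. Qed.
Lemma ideal_mull J r a : is_ideal J -> J a -> J (r * a).
Proof. by case=> _ _; apply. Qed.
Lemma ideal_mulr J r a : is_ideal J -> J a -> J (a * r).
Proof. by rewrite mulrC; apply: ideal_mull. Qed.
Lemma ideal_opp J a : is_ideal J -> J a -> J (- a).
Proof. by move=> HJ Ja; rewrite -mulN1r; apply: ideal_mull. Qed.
Lemma ideal_sub J a b : is_ideal J -> J a -> J b -> J (a - b).
Proof. by move=> HJ Ja Jb; apply: ideal_add => //; apply: ideal_opp. Qed.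
Lemma ideal_sum J (T : Type) (s : seq T) (p : pred T) (F : T -> A) :
  is_ideal J -> (forall i, p i -> J (F i)) -> J (\sum_(i <- s | p i) F i).
Proof.
move=> HJ HF; elim/big_ind: _ => //; first exact: ideal0.
by move=> a b; apply: ideal_add.
Qed.

Lemma idealD_ideal J K : is_ideal J -> is_ideal K -> is_ideal (idealD J K).
Proof.
move=> HJ HK; split.
- by exists 0, 0; split; rewrite ?addr0 //; apply: ideal0.
- move=> _ _ [a [b [Ja Kb ->]]] [c [d [Jc Kd ->]]].
  exists (a + c), (b + d); split; [exact: ideal_add|exact: ideal_add|ring].
- move=> r _ [a [b [Ja Kb ->]]].
  exists (r * a), (r * b); split; [exact: ideal_mull|exact: ideal_mull|ring].
Qed.

Lemma idealI_ideal J K : is_ideal J -> is_ideal K -> is_ideal (idealI J K).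
Proof.
move=> HJ HK; split; first by split; apply: ideal0.
  by move=> a b [Ja Ka] [Jb Kb]; split; apply: ideal_add.
by move=> r a [Ja Ka]; split; apply: ideal_mull.
Qed.

Lemma principal_ideal z : is_ideal (principal z).
Proof.
split; first by exists 0; rewrite mul0r.
  by move=> _ _ [a ->] [b ->]; exists (a + b); rewrite mulrDl.
by move=> r _ [a ->]; exists (r * a); rewrite mulrA.
Qed.

Lemma colon_ideal J z : is_ideal J -> is_ideal (colon J z).
Proof.
move=> HJ; rewrite /colon; split; first by rewrite mulr0; apply: ideal0.
  by move=> a b Ja Jb; rewrite mulrDr; apply: ideal_add.
by move=> r a Ja; rewrite mulrCA; apply: ideal_mull.
Qed.

Lemma gen_ideal_ideal k (y : 'I_k -> A) : is_ideal (gen_ideal y).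
Proof.
split.
- by exists (fun _ => 0); rewrite big1 // => i _; rewrite mul0r.
- move=> _ _ [c ->] [d ->]; exists (fun i => c i + d i).
  by rewrite -big_split; apply: eq_bigr => i _; rewrite mulrDl.
- move=> r _ [c ->]; exists (fun i => r * c i).
  by rewrite mulr_sumr; apply: eq_bigr => i _; rewrite mulrA.
Qed.

Lemma gen_ideal_sub J k (y : 'I_k -> A) : is_ideal J ->
  (forall i, J (y i)) -> subsetR (gen_ideal y) J.
Proof. by move=> HJ Hy _ [c ->]; apply: ideal_sum => // i _; apply: ideal_mull. Qed.

Lemma gen_ideal_mem k (y : 'I_k -> A) i : gen_ideal y (y i).
Proof.
exists (fun j => (j == i)%:R); rewrite (bigD1 i) //= eqxx mul1r big1 ?addr0 //.
by move=> j /negbTE ->; rewrite mul0r.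
Qed.

Lemma ideal_mul_mem J K a b : J a -> K b -> ideal_mul J K (a * b).
Proof.
move=> Ja Kb; exists 1%N, (fun _ => a), (fun _ => b); do 2!split=> //.
by rewrite big_ord1.
Qed.

Lemma ideal_mul_ideal J K : is_ideal J -> is_ideal K -> is_ideal (ideal_mul J K).
Proof.
move=> HJ HK; split.
- by exists 0%N, (fun _ => 0), (fun _ => 0); split=> [[]|] //; split=> [[]|] //; rewrite big_ord0.
- move=> _ _ [k [a [b [Ja [Kb ->]]]]] [l [c [d [Jc [Kd ->]]]]].
  exists (k + l)%N, (fun i => match split i with inl j => a j | inr j => c j end),
    (fun i => match split i with inl j => b j | inr j => d j end).
  split; first by move=> i; case: split.
  split; first by move=> i; case: split.
  rewrite big_split_ord /=; congr (_ + _); apply: eq_bigr => i _.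
    by rewrite (unsplitK (inl i)).
  by rewrite (unsplitK (inr i)).
- move=> r _ [k [a [b [Ja [Kb ->]]]]].
  exists k, (fun i => r * a i), b; split=> [i|]; first exact: ideal_mull.
  by split=> //; rewrite mulr_sumr; apply: eq_bigr => i _; rewrite mulrA.
Qed.

Lemma ideal_mul_sub J K L : is_ideal L ->
  (forall a b, J a -> K b -> L (a * b)) -> subsetR (ideal_mul J K) L.
Proof.
move=> HL H _ [k [a [b [Ja [Kb ->]]]]].
by apply: ideal_sum => // i _; apply: H.
Qed.

Lemma ideal_pow_ideal J k : is_ideal J -> is_ideal (ideal_pow J k).
Proof. by move=> HJ; elim: k => [|k IH] //=; apply: ideal_mul_ideal. Qed.

Lemma ideal_powS_sub J k : is_ideal J -> subsetR (ideal_pow J k.+1) (ideal_pow J k).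
Proof.
move=> HJ; apply: ideal_mul_sub; first exact: ideal_pow_ideal.
by move=> a b _; apply: ideal_mull; apply: ideal_pow_ideal.
Qed.

Lemma ideal_pow_sub J k l : is_ideal J -> (l <= k)%N ->
  subsetR (ideal_pow J k) (ideal_pow J l).
Proof.
move=> HJ /subnK <-; elim: (k - l)%N => [|p IH] // a Ha.
by apply: IH; apply: ideal_powS_sub.
Qed.

Lemma ideal_powM J k l a b : is_ideal J ->
  ideal_pow J k a -> ideal_pow J l b -> ideal_pow J (k + l) (a * b).
Proof.
move=> HJ Ha Hb; have HI p := ideal_pow_ideal p HJ.
elim: k a Ha => [|k IH] a Ha; first exact: ideal_mull.
suff : subsetR (ideal_pow J k.+1) (colon (ideal_pow J (k.+1 + l)) b).
  by move/(_ _ Ha); rewrite /colon mulrC.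
apply: ideal_mul_sub; first exact: colon_ideal.
move=> c d Jc Hd; rewrite /colon mulrC -mulrA.
by apply: ideal_mul_mem => //; apply: IH.
Qed.

Lemma ideal_powD J k l : is_ideal J ->
  subsetR (ideal_pow J (k + l)) (ideal_mul (ideal_pow J k) (ideal_pow J l)).
Proof.
move=> HJ; have HI p := ideal_pow_ideal p HJ.
elim: k => [|k IH] a.
  by move=> Ha; rewrite -(mul1r a); apply: ideal_mul_mem.
move: a; apply: ideal_mul_sub; first exact: ideal_mul_ideal.
move=> a b Ja /IH [p [c [d [Hc [Hd ->]]]]]; rewrite mulr_sumr.
apply: ideal_sum => [|i _]; first exact: ideal_mul_ideal.
rewrite mulrA; apply: ideal_mul_mem (Hd i); exact: ideal_mul_mem Ja (Hc i).
Qed.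

Lemma ideal_powX J k a : J a -> ideal_pow J k (a ^+ k).
Proof. by move=> Ja; elim: k => [|k IH] //; rewrite exprS; apply: ideal_mul_mem. Qed.

End Ideals.

Section LocalColength.
Variables (A : comNzRingType) (P : A -> Prop).
Hypothesis Pprime : is_prime P.
Implicit Types J K L : A -> Prop.

Let Pid : is_ideal P. Proof. by case: Pprime => -[]. Qed.
Let P1 : ~ P 1. Proof. by case: Pprime => -[]. Qed.
Let PM a b : ~ P a -> ~ P b -> ~ P (a * b).
Proof. by move=> Ha Hb Hab; case: Pprime => _ /(_ _ _ Hab) []. Qed.
Let PB a b : ~ P a -> P b -> ~ P (a - b).
Proof. by move=> Ha Hb H; apply: Ha; rewrite -(subrK b a); apply: ideal_add. Qed.

(* [loc_mem J a]: a/1 lies in J A_P.  Working with this relation on ideals of A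
   avoids constructing the localization A_P. *)
Definition loc_mem J a := exists s, ~ P s /\ J (s * a).
Definition loc_sub J K := forall a, J a -> loc_mem K a.

Lemma loc_memW J a : J a -> loc_mem J a.
Proof. by move=> Ja; exists 1; split=> //; rewrite mul1r. Qed.

Lemma loc_subW J K : subsetR J K -> loc_sub J K.
Proof. by move=> H a /H; apply: loc_memW. Qed.

Lemma loc_mem_trans J K a : loc_sub J K -> loc_mem J a -> loc_mem K a.
Proof.
move=> JK [s [Ps /JK [t [Pt Ht]]]]; exists (t * s).
by split; [exact: PM|rewrite -mulrA].
Qed.

Lemma loc_sub_refl J : loc_sub J J. Proof. exact: loc_subW. Qed.

Lemma loc_sub_trans J K L : loc_sub J K -> loc_sub K L -> loc_sub J L.
Proof. by move=> JK KL a /JK; apply: loc_mem_trans. Qed.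

Lemma loc_mem_ideal J : is_ideal J -> is_ideal (loc_mem J).
Proof.
move=> HJ; split; first by apply: loc_memW; apply: ideal0.
- move=> a b [s [Ps Ha]] [t [Pt Hb]]; exists (s * t); split; first exact: PM.
  have -> : s * t * (a + b) = t * (s * a) + s * (t * b) by ring.
  by apply: ideal_add => //; apply: ideal_mull.
- move=> r a [s [Ps Ha]]; exists s; split=> //.
  by rewrite mulrCA; apply: ideal_mull.
Qed.

Lemma loc_mem_cancel J s a : ~ P s -> loc_mem J (s * a) -> loc_mem J a.
Proof. by move=> Ps [t [Pt H]]; exists (t * s); split; [exact: PM|rewrite -mulrA]. Qed.

Lemma loc_mem_colon J z a : loc_mem (colon J z) a <-> loc_mem J (z * a).
Proof. by split=> -[s [Ps H]]; exists s; split=> //; move: H; rewrite /colon mulrCA. Qed.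

Lemma loc_mem1 J : is_ideal J -> loc_mem J 1 -> forall a, loc_mem J a.
Proof. by move=> HJ H a; rewrite -[a]mulr1; apply: ideal_mull => //; apply: loc_mem_ideal. Qed.

Lemma loc_nakayama1 J a : is_ideal J -> P a ->
  loc_mem (idealD J (principal a)) 1 -> loc_mem J 1.
Proof.
move=> HJ Pa [s [Ps [b [c [Jb [d ->] E]]]]].
exists (s - d * a); split; first by apply: PB => //; apply: ideal_mull.
by rewrite mulr1; move: E; rewrite mulr1 => ->; rewrite addrK.
Qed.

(* [colen_ge l J]: the colength of J A_P is at least l. *)
Fixpoint colen_ge (l : nat) J : Prop :=
  if l is l'.+1 then
    exists K, [/\ is_ideal K, loc_sub J K, ~ loc_sub K J & colen_ge l' K]
  else True.

Lemma colen_ge_mono l J K : loc_sub J K -> colen_ge l K -> colen_ge l J.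
Proof.
case: l => [|l] //= JK [L [HL KL nLK HlL]]; exists L; split=> //.
  exact: loc_sub_trans KL.
by move=> LJ; apply: nLK; apply: loc_sub_trans JK.
Qed.

Lemma colen_geW l J : colen_ge l.+1 J -> colen_ge l J.
Proof. by move=> [K [_ JK _ HK]]; apply: colen_ge_mono HK. Qed.

Lemma colen_ge_le k l J : (k <= l)%N -> colen_ge l J -> colen_ge k J.
Proof.
move=> /subnK <-; elim: (l - k)%N => [|p IH] // H.
by apply: IH; apply: colen_geW.
Qed.

Lemma colen_ge1 J : is_ideal J -> ~ colen_ge 1 J -> loc_mem J 1.
Proof.
move=> HJ H; apply: NNPP => H1; apply: H; exists (@whole A); split=> //.
  exact: loc_subW.
by move=> /(_ 1 Logic.I).
Qed.

Lemma colen_ge1N J : is_ideal J -> loc_mem J 1 -> ~ colen_ge 1 J.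
Proof. by move=> HJ J1 [K [_ _ H _]]; apply: H => a _; apply: loc_mem1. Qed.

Lemma colen_ge2N J : is_ideal J -> subsetR P J -> ~ colen_ge 2 J.
Proof.
move=> HJ PJ [K [HK JK nKJ H]]; apply: (colen_ge1N HK) H.
have [a aP] := not_all_ex_not _ _ nKJ; have [Ka nJa] := imply_to_and _ _ aP.
exists a; split; last by rewrite mulr1.
by move=> Pa; apply: nJa; apply: loc_memW; apply: PJ.
Qed.

(** Additivity of length in abstract form. The last condition on [f] and [g] is a modular law: a
    strict step of a chain above [base] stays strict under [f] or under [g], and is charged to that
    one. *)
Lemma colen_ge_split (f g : (A -> Prop) -> A -> Prop) (base : A -> Prop) l U :
  (forall J K, is_ideal J -> is_ideal K -> loc_sub J K -> loc_sub (f J) (f K)) ->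
  (forall J K, is_ideal J -> is_ideal K -> loc_sub J K -> loc_sub (g J) (g K)) ->
  (forall J, is_ideal J -> is_ideal (f J)) ->
  (forall J, is_ideal J -> is_ideal (g J)) ->
  (forall J K, is_ideal J -> is_ideal K -> loc_sub base J -> loc_sub J K ->
     loc_sub (f K) (f J) -> loc_sub (g K) (g J) -> loc_sub K J) ->
  is_ideal U -> loc_sub base U -> colen_ge l U ->
  exists a b, [/\ (l <= a + b)%N, colen_ge a (f U) & colen_ge b (g U)].
Proof.
move=> fm gm fi gi H; elim: l U => [|l IH] U HU bU; first by exists 0%N, 0%N.
move=> [K [HK UK nKU /(IH K HK (loc_sub_trans bU UK)) [a [b [le_l Ha Hb]]]]].
have [fKU|nf] := classic (loc_sub (f K) (f U)); last first.
  exists a.+1, b; split; first by rewrite addSn.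
    by exists (f K); split=> //; [exact: fi|exact: fm].
  by apply: colen_ge_mono Hb; apply: gm.
exists a, b.+1; split; first by rewrite addnS.
  by apply: colen_ge_mono Ha; apply: fm.
exists (g K); split=> //; [exact: gi|exact: gm|].
by move=> gKU; apply: nKU; apply: H gKU.
Qed.

Lemma loc_sub_idealD J J' K : is_ideal J' -> is_ideal K ->
  loc_sub J J' -> loc_sub (idealD J K) (idealD J' K).
Proof.
move=> HJ' HK JJ' _ [a [b [/JJ' [s [Ps Ha]] Kb ->]]]; exists s; split=> //.
by exists (s * a), (s * b); split=> //; [exact: ideal_mull|rewrite mulrDr].
Qed.

Lemma loc_sub_colon J K z : loc_sub J K -> loc_sub (colon J z) (colon K z).
Proof. by move=> JK a Ja; apply/loc_mem_colon; apply: JK. Qed.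

Lemma colon_sub J z : is_ideal J -> subsetR J (colon J z).
Proof. by move=> HJ a; apply: ideal_mull. Qed.

Lemma idealD_subl J K : is_ideal K -> subsetR J (idealD J K).
Proof. by move=> HK a Ja; exists a, 0; split; rewrite ?addr0 //; apply: ideal0. Qed.

Lemma idealD_subr J K : is_ideal J -> subsetR K (idealD J K).
Proof. by move=> HJ a Ka; exists 0, a; split; rewrite ?add0r //; apply: ideal0. Qed.

Lemma idealD_sub J K L : is_ideal L -> subsetR J L -> subsetR K L ->
  subsetR (idealD J K) L.
Proof. by move=> HL JL KL _ [a [b [/JL Ha /KL Hb ->]]]; apply: ideal_add. Qed.

Lemma idealD_loc_sub J K L : is_ideal L -> loc_sub J L -> loc_sub K L ->
  loc_sub (idealD J K) L.
Proof.
by move=> HL JL KL; apply: (@idealD_sub J K (loc_mem L)) => //; apply: loc_mem_ideal.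
Qed.

(** Upper half of length additivity along [0 -> A/(Q:z) -> A/Q -> A/(Q+z) -> 0], whose first map is
    multiplication by [z]. *)
Lemma colen_ge_colon l Q z : is_ideal Q -> colen_ge l Q ->
  exists a b, [/\ (l <= a + b)%N, colen_ge a (idealD Q (principal z))
    & colen_ge b (colon Q z)].
Proof.
move=> HQ; have Hz := principal_ideal z.
apply: (@colen_ge_split (fun J => idealD J (principal z)) (fun J => colon J z) Q) => //;
  last exact: loc_sub_refl.
- by move=> J K HJ HK; apply: loc_sub_idealD.
- by move=> J K HJ HK; apply: loc_sub_colon.
- by move=> J HJ; apply: idealD_ideal.
- by move=> J HJ; apply: colon_ideal.
move=> J K HJ HK _ JK H1 H2 a Ka.
have [s [Ps [q [_ [Jq [b ->] E]]]]] : loc_mem (idealD J (principal z)) a.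
  by apply: H1; apply: idealD_subl.
apply: (@loc_mem_cancel _ s) => //; rewrite E.
apply: (ideal_add (loc_mem_ideal HJ)); first exact: loc_memW.
rewrite mulrC; apply/loc_mem_colon; apply: loc_mem_trans H2 _.
apply/loc_mem_colon; rewrite mulrC.
have -> : b * z = s * a - q by rewrite E addrC addKr.
apply: ideal_sub; [exact: loc_mem_ideal| |exact: JK].
by apply: loc_memW; apply: ideal_mull.
Qed.

(** Lower half of the same additivity: a chain above [Q : z] is transported by [K |-> Q + zK] and
    continued by the chain above [Q + (z)]. *)
Lemma colen_ge_colonD a b Q z : is_ideal Q ->
  colen_ge a (idealD Q (principal z)) -> colen_ge b (colon Q z) ->
  colen_ge (a + b) Q.
Proof.
have Hz := principal_ideal z.
elim: b Q => [|b IH] Q HQ Ha.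
  rewrite addn0 => _; apply: colen_ge_mono Ha.
  by apply: loc_subW; apply: idealD_subl.
move=> [K [HK QK nKQ Hb]].
(* [Q' = Q + zK] stays inside [Q + (z)], and [Q' : z] is locally inside [K] because [Q : z] is; so
   the induction hypothesis applies to [Q']. *)
pose Q' := idealD Q (fun c => exists2 k, K k & c = k * z).
have HzK : is_ideal (fun c => exists2 k, K k & c = k * z).
  split; first by exists 0; rewrite ?mul0r //; apply: ideal0.
    by move=> _ _ [k Kk ->] [l Kl ->]; exists (k + l); [exact: ideal_add|ring].
  by move=> r _ [k Kk ->]; exists (r * k); [exact: ideal_mull|ring].
have HQ' : is_ideal Q' by apply: idealD_ideal.
have QQ' : subsetR Q Q' by apply: idealD_subl.
rewrite addnS; exists Q'; split=> //; first exact: loc_subW.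
  move=> Q'Q; apply: nKQ => k Kk; apply/loc_mem_colon; apply: Q'Q.
  by rewrite mulrC; apply: idealD_subr => //; exists k.
apply: IH => //.
  apply: colen_ge_mono Ha; apply: loc_subW; apply: idealD_sub.
  - exact: idealD_ideal.
  - apply: idealD_sub; [exact: idealD_ideal|exact: idealD_subl|].
    by move=> _ [k _ ->]; apply: idealD_subr => //; exists k.
  - exact: idealD_subr.
apply: colen_ge_mono Hb => c [q [_ [Qq [k Kk ->] E]]].
have -> : c = k + (c - k) by rewrite addrC subrK.
apply: (ideal_add (loc_mem_ideal HK)); first exact: loc_memW.
by apply: QK; rewrite /colon mulrBr E [k * z]mulrC addrK.
Qed.

(** [A/(V ∩ W)] has quotient [A/V] and kernel [V/(V ∩ W)], which embeds in [A/W]. The two maps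
    [J + V] and [(J ∩ V) + W] follow these two pieces. *)
Lemma colen_ge_idealI l V W : is_ideal V -> is_ideal W ->
  colen_ge l (idealI V W) ->
  exists a b, [/\ (l <= a + b)%N, colen_ge a V & colen_ge b W].
Proof.
move=> HV HW; have HI := idealI_ideal HV HW.
case/(@colen_ge_split (fun U => idealD U V)
  (fun U => idealD (idealI U V) W) (idealI V W)) => //.
- by move=> J K HJ HK; apply: loc_sub_idealD.
- move=> J K HJ HK JK; apply: loc_sub_idealD => //; first exact: idealI_ideal.
  move=> a [/JK [s [Ps Ha]] Va]; exists s; do 2!split=> //; exact: ideal_mull.
- by move=> J HJ; apply: idealD_ideal.
- by move=> J HJ; apply: idealD_ideal => //; apply: idealI_ideal.
- move=> J K HJ HK bJ JK H1 H2 a Ka.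
  have [s [Ps [u [v [Ju Vv E]]]]] : loc_mem (idealD J V) a.
    by apply: H1; apply: idealD_subl.
  apply: (@loc_mem_cancel _ s) => //; rewrite E.
  apply: (ideal_add (loc_mem_ideal HJ)); first exact: loc_memW.
  have [t [Pt Kv]] : loc_mem K v.
    have -> : v = s * a - u by rewrite E addrC addKr.
    apply: ideal_sub; [exact: loc_mem_ideal| |exact: JK].
    by apply: loc_memW; apply: ideal_mull.
  have [t' [Pt' [p [w [[Jp Vp] Ww E']]]]] : loc_mem (idealD (idealI J V) W) (t * v).
    apply: H2; apply: idealD_subl => //; split=> //; exact: ideal_mull.
  apply: (@loc_mem_cancel _ (t' * t)); first exact: PM.
  rewrite -mulrA E'; apply: (ideal_add (loc_mem_ideal HJ)); first exact: loc_memW.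
  apply: bJ; split=> //.
  have -> : w = t' * (t * v) - p by rewrite E' addrC addKr.
  by apply: ideal_sub => //; do 2!apply: ideal_mull => //.
- exact: loc_sub_refl.
move=> a [b [le_l Ha Hb]]; exists a, b; split=> //.
  by apply: colen_ge_mono Ha; apply: loc_subW; apply: idealD_subr.
by apply: colen_ge_mono Hb; apply: loc_subW; apply: idealD_subr; apply: idealI_ideal.
Qed.

(** One factor [a] of [P] is removed at a time: [J : a] has smaller colength than [J] unless
    [J + (a)] is the unit ideal, and then Nakayama makes [J] the unit ideal too. *)
Lemma ideal_pow_loc_sub l J : is_ideal J -> ~ colen_ge l.+1 J ->
  loc_sub (ideal_pow P l) J.
Proof.
elim: l J => [|l IH] J HJ HlJ; first by move=> a _; apply: loc_mem1 => //; apply: colen_ge1.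
apply: ideal_mul_sub; first exact: loc_mem_ideal.
move=> a b Pa Hb.
have [Hl|Hl] := classic (colen_ge l.+1 (colon J a)); last first.
  by apply/loc_mem_colon; apply: IH Hb => //; apply: colon_ideal.
apply: loc_mem1 => //; apply: (loc_nakayama1 HJ Pa); apply: colen_ge1.
  by apply: idealD_ideal => //; apply: principal_ideal.
by move=> H1; apply: HlJ; rewrite -addn1 addnC; apply: colen_ge_colonD H1 Hl.
Qed.

Definition finite_colen J := exists b, ~ colen_ge b J.

(* The colength of J A_P; a junk value when that is infinite. *)
Definition colen J : nat := epsilon (inhabits 0%N)
  (fun l => forall k, colen_ge k J <-> (k <= l)%N).

Lemma colen_geP J : finite_colen J -> forall k, colen_ge k J <-> (k <= colen J)%N.
Proof.
move=> [b Hb]; apply: (epsilon_spec (inhabits 0%N)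
  (fun l => forall k, colen_ge k J <-> (k <= l)%N)).
elim: b Hb => [|b IH] Hb; first by case: Hb.
have [Hb'|/IH //] := classic (colen_ge b J).
exists b => k; split; last by move=> /colen_ge_le; apply.
by move=> Hk; rewrite leqNgt; apply/negP => /colen_ge_le /(_ Hk).
Qed.

Lemma colen_eq J l : colen_ge l J -> ~ colen_ge l.+1 J -> colen J = l.
Proof.
move=> H1 H2; have /colen_geP H : finite_colen J by exists l.+1.
by apply/eqP; rewrite eqn_leq; apply/andP; split;
  [rewrite leqNgt; apply/negP => /H|apply/H].
Qed.

Lemma finite_colen_sub J K : loc_sub J K -> finite_colen J -> finite_colen K.
Proof. by move=> JK [b Hb]; exists b => H; apply: Hb; apply: colen_ge_mono H. Qed.

Lemma leq_colen J K : loc_sub J K -> finite_colen J -> (colen K <= colen J)%N.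
Proof.
move=> JK FJ; apply/(colen_geP FJ); apply: (colen_ge_mono JK).
by apply/(colen_geP (finite_colen_sub JK FJ)).
Qed.

Lemma ltn_colen J K : is_ideal K -> loc_sub J K -> ~ loc_sub K J ->
  finite_colen J -> (colen K < colen J)%N.
Proof.
move=> HK JK nKJ FJ; apply/(colen_geP FJ); exists K; split=> //.
by apply/(colen_geP (finite_colen_sub JK FJ)).
Qed.

Lemma colen_colon Q z : is_ideal Q -> finite_colen Q ->
  colen Q = (colen (idealD Q (principal z)) + colen (colon Q z))%N.
Proof.
move=> HQ FQ; have Hz := principal_ideal z.
have F1 : finite_colen (idealD Q (principal z)).
  by apply: finite_colen_sub FQ; apply: loc_subW; apply: idealD_subl.
have F2 : finite_colen (colon Q z).
  by apply: finite_colen_sub FQ; apply: loc_subW; apply: colon_sub.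
apply/eqP; rewrite eqn_leq; apply/andP; split.
  have [a [b [le_l /(colen_geP F1) Ha /(colen_geP F2) Hb]]] :
    exists a b, [/\ (colen Q <= a + b)%N, colen_ge a (idealD Q (principal z))
      & colen_ge b (colon Q z)].
    by apply: colen_ge_colon => //; apply/(colen_geP FQ).
  by apply: leq_trans le_l _; apply: leq_add.
apply/(colen_geP FQ); apply: (@colen_ge_colonD _ _ _ z) => //.
  exact/(colen_geP F1).
exact/(colen_geP F2).
Qed.

Lemma colen_idealI V W : is_ideal V -> is_ideal W ->
  finite_colen (idealI V W) -> (colen (idealI V W) <= colen V + colen W)%N.
Proof.
move=> HV HW FI.
have F1 : finite_colen V by apply: finite_colen_sub FI; apply: loc_subW => a [].
have F2 : finite_colen W by apply: finite_colen_sub FI; apply: loc_subW => a [].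
have /(colen_ge_idealI HV HW) : colen_ge (colen (idealI V W)) (idealI V W).
  exact/(colen_geP FI).
move=> [a [b [le_l /(colen_geP F1) Ha /(colen_geP F2) Hb]]].
by apply: leq_trans le_l _; apply: leq_add.
Qed.

Lemma colen1 J : is_ideal J -> loc_mem J 1 -> colen J = 0%N.
Proof. by move=> HJ J1; apply: colen_eq => //; apply: colen_ge1N. Qed.

Lemma colen_eq0 J : is_ideal J -> finite_colen J -> colen J = 0%N -> loc_mem J 1.
Proof. by move=> HJ /colen_geP FJ J0; apply: colen_ge1 => // /FJ; rewrite J0. Qed.

Lemma colen_prime_sub J : is_ideal J -> subsetR P J -> (colen J <= 1)%N.
Proof.
move=> HJ PJ; have F : finite_colen J by exists 2; apply: colen_ge2N.
by rewrite leqNgt; apply/negP => /(colen_geP F); apply: colen_ge2N.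
Qed.

(** The drop in colength is the colength of [J : u], and that ideal contains [P] locally. *)
Lemma colen_idealD_principal J u : is_ideal J -> finite_colen J ->
  (forall b, P b -> loc_mem J (u * b)) ->
  (colen J <= (colen (idealD J (principal u))).+1)%N.
Proof.
move=> HJ FJ Hu; rewrite (colen_colon u HJ FJ) -addn1 leq_add2l.
have HC := colon_ideal u HJ.
have FC : finite_colen (colon J u).
  by apply: finite_colen_sub FJ; apply: loc_subW; apply: colon_sub.
(* Saturating [J : u] turns the local inclusion of [P] into a literal one, as [colen_prime_sub]
   requires. *)
have FL : finite_colen (loc_mem (colon J u)).
  by apply: finite_colen_sub FC; apply: loc_subW => a; apply: loc_memW.
apply: leq_trans (colen_prime_sub (loc_mem_ideal HC) _).
  by apply: leq_colen => // a.
by move=> b Pb; apply/loc_mem_colon; apply: Hu.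
Qed.

End LocalColength.

(** * Noetherian rings and the Rees algebra *)

Section Noetherian.
Variable A : comNzRingType.
Implicit Types J K : A -> Prop.

Lemma union_chain_ideal (L : nat -> A -> Prop) :
  (forall i, is_ideal (L i)) -> (forall i, subsetR (L i) (L i.+1)) ->
  is_ideal (fun a => exists i, L i a).
Proof.
move=> HL Lle; have Lmono i j : (i <= j)%N -> subsetR (L i) (L j).
  move=> /subnK <-; elim: (j - i)%N => [|p IH] // a /IH; exact: Lle.
split; first by exists 0%N; apply: ideal0.
  move=> a b [i Ha] [j Hb]; exists (maxn i j); apply: ideal_add => //.
    by apply: Lmono Ha; apply: leq_maxl.
  by apply: Lmono Hb; apply: leq_maxr.
by move=> r a [i Ha]; exists i; apply: ideal_mull.
Qed.

Lemma noetherian_chain (L : nat -> A -> Prop) : noetherian A ->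
  (forall i, is_ideal (L i)) -> (forall i, subsetR (L i) (L i.+1)) ->
  exists N, forall i, subsetR (L i) (L N).
Proof.
move=> NA HL Lle; have Lmono i j : (i <= j)%N -> subsetR (L i) (L j).
  move=> /subnK <-; elim: (j - i)%N => [|p IH] // a /IH; exact: Lle.
have [k [y Hy]] := NA _ (union_chain_ideal HL Lle).
have /fin_all_exists [d Hd] : forall i : 'I_k, exists d, L d (y i).
  by move=> i; apply/Hy; apply: gen_ideal_mem.
exists (\max_i d i) => j a Ha.
have : gen_ideal y a by apply/Hy; exists j.
apply: gen_ideal_sub => // i; apply: Lmono (Hd i); exact: leq_bigmax.
Qed.

Lemma noetherian_maximal (F : (A -> Prop) -> Prop) J0 : noetherian A ->
  (forall J, F J -> is_ideal J) -> F J0 ->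
  exists J, [/\ F J, subsetR J0 J & forall K, F K -> subsetR J K -> subsetR K J].
Proof.
move=> NA FI F0; apply: NNPP => Hno.
pose T := {J : A -> Prop | F J /\ subsetR J0 J}.
have step (J : T) : exists K : T, subsetR (sval J) (sval K) /\ ~ subsetR (sval K) (sval J).
  case: J => J [FJ J0J] /=; apply: NNPP => Hn; apply: Hno; exists J; split=> // K FK JK.
  apply: NNPP => nKJ; apply: Hn.
  by exists (exist _ K (conj FK (fun a Ha => JK a (J0J a Ha)))).
pose next (J : T) : T := proj1_sig (constructive_indefinite_description _ (step J)).
have nextP (J : T) : subsetR (sval J) (sval (next J)) /\ ~ subsetR (sval (next J)) (sval J).
  exact: proj2_sig (constructive_indefinite_description _ (step J)).
pose s i := iter i next (exist _ J0 (conj F0 (fun a => id)) : T).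
have [N HN] : exists N, forall i, subsetR (sval (s i)) (sval (s N)).
  apply: noetherian_chain => // i; first by apply: FI; case: (svalP (s i)).
  by have [] := nextP (s i).
by have [_] := nextP (s N); apply; apply: (HN N.+1).
Qed.

(** Without an inverse for [a], an ideal maximal among the proper ones containing [a] would be a
    maximal ideal, hence [M]. *)
Lemma local_unit (M : A -> Prop) a : noetherian A -> local_with_max M ->
  ~ M a -> exists b, b * a = 1.
Proof.
move=> NA [_ HM] nMa; apply: NNPP => Hna.
have [|//|J [[HJ J1] aJ Jmax]] := @noetherian_maximal (@Defs.proper A) (principal a) NA.
- by move=> J [].
- split; first exact: principal_ideal.
  by case=> b E; apply: Hna; exists b.
have maxJ : is_maximal J.
  split=> // K HK JK; have [K1|K1] := classic (K 1); [by right|left=> b].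
  by split; [apply: Jmax|apply: JK].
by apply: nMa; apply/(HM J maxJ); apply: aJ; exists 1; rewrite mul1r.
Qed.

Definition fin_gen J := exists k (y : 'I_k -> A), eqsetR J (gen_ideal y).

Lemma fin_genD J K : is_ideal J -> is_ideal K ->
  fin_gen J -> fin_gen K -> fin_gen (idealD J K).
Proof.
move=> HJ HK [k [y Hy]] [l [z Hz]].
pose w i := match split i with inl j => y j | inr j => z j end.
have wl j : w (lshift l j) = y j by rewrite /w (unsplitK (inl j)).
have wr j : w (rshift k j) = z j by rewrite /w (unsplitK (inr j)).
exists (k + l)%N, w => a; split.
  apply: idealD_sub; first exact: gen_ideal_ideal.
    move=> b /Hy; apply: gen_ideal_sub; first exact: gen_ideal_ideal.
    by move=> i; rewrite -wl; apply: gen_ideal_mem.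
  move=> b /Hz; apply: gen_ideal_sub; first exact: gen_ideal_ideal.
  by move=> i; rewrite -wr; apply: gen_ideal_mem.
apply: gen_ideal_sub; first exact: idealD_ideal.
move=> i; rewrite /w; case: (split i) => j.
  by apply: idealD_subl => //; apply/Hy; apply: gen_ideal_mem.
by apply: idealD_subr => //; apply/Hz; apply: gen_ideal_mem.
Qed.

End Noetherian.

Lemma hilbert_basis (A : comNzRingType) : noetherian A -> noetherian {poly A}.
Proof.
move=> NA Q HQ.
pose L d a := exists p : {poly A}, [/\ Q p, (size p <= d.+1)%N & p`_d = a].
have HL d : is_ideal (L d).
  split; first by exists 0; rewrite size_poly0 coef0; split=> //; apply: ideal0.
    move=> _ _ [p [Qp sp <-]] [q [Qq sq <-]]; exists (p + q).
    rewrite coefD; split=> //; first exact: ideal_add.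
    by apply: leq_trans (size_polyD _ _) _; rewrite geq_max sp.
  move=> r _ [p [Qp sp <-]]; exists (r%:P * p).
  rewrite coefCM; split=> //; first exact: ideal_mull.
  by rewrite mul_polyC; apply: leq_trans (size_scale_leq _ _) _.
(* Multiplication by ['X] makes the ideals of degree [d] leading coefficients increase with [d], so
   they are all contained in one of them. *)
have [D HD] : exists D, forall d, subsetR (L d) (L D).
  apply: noetherian_chain => // d _ [p [Qp sp <-]]; exists (p * 'X).
  rewrite coefMX; split=> //; first exact: ideal_mulr.
  by apply: leq_trans (size_polyMleq _ _) _; rewrite size_polyX addn2.
have low d : exists F, [/\ is_ideal F, fin_gen F, subsetR F Q &
    forall p, Q p -> (size p <= d)%N -> F p].
  elim: d => [|d [F [HF FF FQ Fd]]].
    exists (gen_ideal (fun i : 'I_0 => 0)); split; first exact: gen_ideal_ideal.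
    - by exists 0%N, (fun i : 'I_0 => 0).
    - by apply: gen_ideal_sub => // -[].
    - move=> p _; rewrite leqn0 size_poly_eq0 => /eqP ->.
      by apply: ideal0; apply: gen_ideal_ideal.
  have [k [y Hy]] := NA _ (HL d).
  have /fin_all_exists [q Hq] : forall i : 'I_k, L d (y i).
    by move=> i; apply/Hy; apply: gen_ideal_mem.
  have Hgen := gen_ideal_ideal q.
  exists (idealD F (gen_ideal q)); split; first exact: idealD_ideal.
  - by apply: fin_genD => //; exists k, q.
  - by apply: idealD_sub => //; apply: gen_ideal_sub => // i; case: (Hq i).
  move=> p Qp sp; have [c Ec] : gen_ideal y p`_d by apply/Hy; exists p.
  exists (p - \sum_(i < k) (c i)%:P * q i), (\sum_(i < k) (c i)%:P * q i).
  split; [apply: Fd | by exists (fun i => (c i)%:P) | by rewrite subrK].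
    apply: ideal_sub => //; apply: ideal_sum => // i _.
    by apply: ideal_mull => //; case: (Hq i).
  apply/leq_sizeP => j; rewrite coefB coef_sum leq_eqVlt => /orP[/eqP <-|dj].
    rewrite Ec [X in _ - X](eq_bigr (fun i => c i * y i)) ?subrr //.
    by move=> i _; rewrite coefCM; case: (Hq i) => _ _ ->.
  rewrite [p`_j]nth_default ?(leq_trans sp) // sub0r big1 ?oppr0 // => i _.
  by rewrite coefCM nth_default ?mulr0 //; case: (Hq i) => _ /leq_trans ->.
have [F [HF [k [y Hy]] FQ Flow]] := low D.+1; exists k, y => p; split; last by move/Hy/FQ.
move=> Qp; apply/Hy; have [s] := ubnP (size p); elim: s p Qp => // s IH p Qp.
rewrite ltnS leq_eqVlt => /orP[/eqP sp|]; last by rewrite -ltnS; apply: IH.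
have [|Ds] := leqP s D.+1; first by rewrite -sp; apply: Flow.
case: s sp Ds IH => // s sp Ds IH.
have [q [Qq sq Eq]] : L D p`_s by apply: (HD s); exists p; rewrite sp.
(* The leading coefficient of [p] is already the degree [D] coefficient of some [q] in [F];
   subtracting a shift of [q] lowers the size. *)
have -> : p = (p - 'X^(s - D) * q) + 'X^(s - D) * q by rewrite subrK.
have Fq : F q by apply: Flow.
apply: ideal_add => //; last exact: ideal_mull.
apply: IH; first by apply: ideal_sub => //; apply: ideal_mull.
rewrite ltnS; apply/leq_sizeP => j; rewrite coefB coefXnM leq_eqVlt => /orP[/eqP <-|sj].
  by rewrite ltnNge leq_subr /= subKn ?Eq ?subrr //; lia.
rewrite [p`_j]nth_default ?sp // sub0r; case: ifP; rewrite ?oppr0 // => _.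
by rewrite nth_default ?oppr0 //; apply: leq_trans sq _; clear -Ds sj; lia.
Qed.

(** * The Rees algebra and the torsion of the associated graded ring *)

Section Rees.
Variables (R : comNzRingType) (m : R -> Prop).
Hypothesis Hm : is_ideal m.
Let HI k := ideal_pow_ideal k Hm.

Definition rees (p : {poly R}) := forall i, ideal_pow m i p`_i.

Lemma reesM p q : rees p -> rees q -> rees (p * q).
Proof.
move=> Hp Hq i; rewrite coefM; apply: ideal_sum => // j _.
have {1}-> : i = (j + (i - j))%N by rewrite subnKC // -ltnS.
exact: ideal_powM.
Qed.

Lemma reesC r : rees r%:P.
Proof.
move=> [|i] //; rewrite coefC; exact: ideal0 (HI i.+1).
Qed.

(** [B] is an iterated polynomial ring over [R] with one variable for each element of [cs]. Pulling
    ideals back to it gives the use of a noetherian Rees algebra without making [rees] into a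
    ring. *)
Lemma rees_noetherian_cover (cs : seq {poly R}) : noetherian R ->
  (forall c, c \in cs -> rees c) ->
  exists (B : comNzRingType) (phi : {rmorphism B -> {poly R}}),
    [/\ noetherian B, (forall b, rees (phi b)), (forall r, exists b, phi b = r%:P)
      & (forall c, c \in cs -> exists b, phi b = c)].
Proof.
move=> NR; elim: cs => [|c cs IH] Hcs.
  exists R, polyC; split=> //; first by move=> b; apply: reesC.
  by move=> r; exists r.
have [|B [phi [NB Hphi Hc Hs]]] := IH.
  by move=> d d_in; apply: Hcs; rewrite inE d_in orbT.
have cc : commr_rmorph phi c by move=> b; apply: mulrC.
exists {poly B}, (horner_morph cc); split; first exact: hilbert_basis.
- move=> p; suff : rees (map_poly phi p).[c] by [].
  rewrite horner_coef => i; rewrite coef_sum; apply: ideal_sum => // j _; move: i.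
  suff : rees ((map_poly phi p)`_j * c ^+ j) by []; rewrite coef_map.
  apply: reesM; first exact: Hphi.
  elim: (j : nat) => [|k IHk]; first by rewrite expr0 -polyC1; apply: reesC.
  by rewrite exprS; apply: reesM => //; apply: Hcs; rewrite inE eqxx.
- by move=> r; have [b <-] := Hc r; exists b%:P; apply: (horner_morphC cc).
move=> d; rewrite inE => /orP[/eqP ->|/Hs [b <-]].
  by exists 'X; apply: (horner_morphX cc).
by exists b%:P; apply: (horner_morphC cc).
Qed.

(* The degree [i] part of the torsion of gr_m R supported at the irrelevant ideal. *)
Definition gr_torsion i a := ideal_pow m i a /\
  exists p, forall g, ideal_pow m p g -> ideal_pow m (i + p).+1 (g * a).

Lemma gr_torsionM i d r a : ideal_pow m d r -> gr_torsion i a ->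
  gr_torsion (d + i) (r * a).
Proof.
move=> Hr [Ha [p Hp]]; split; first exact: ideal_powM.
exists p => g /Hp Hg; rewrite mulrCA -addnA -addnS.
exact: ideal_powM.
Qed.

Lemma gr_torsion_ideal i : is_ideal (gr_torsion i).
Proof.
split.
- split; first exact: ideal0.
  by exists 0%N => g _; rewrite mulr0; apply: ideal0.
- move=> a b [Ha [p Hp]] [Hb [q Hq]]; split; first exact: ideal_add.
  exists (p + q)%N => g Hg; rewrite mulrDr; apply: ideal_add => //.
    have [k [c [d [Hc [Hd ->]]]]] := ideal_powD Hm Hg.
    rewrite mulr_suml; apply: ideal_sum => // j _.
    rewrite mulrAC addnA -addSn; apply: ideal_powM => //; exact: Hp.
  have [k [c [d [Hc [Hd ->]]]]] := ideal_powD Hm Hg.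
  rewrite mulr_suml; apply: ideal_sum => // j _.
  have -> : (i + (p + q)).+1 = (p + (i + q).+1)%N by lia.
  rewrite -mulrA; apply: ideal_powM => //; exact: Hq.
- by move=> r a; apply: (@gr_torsionM i 0).
Qed.

(** Only finitely many coefficients of [q] matter. For large [i] the cofactor of [q_j] has order at
    least [p j], which is enough to kill its class in the graded ring. *)
Lemma gr_torsion_poly_bound (q : {poly R}) : (forall i, gr_torsion i q`_i) ->
  exists b, forall i (r : {poly R}), (b <= i)%N -> rees r ->
    ideal_pow m i.+1 (r * q)`_i.
Proof.
move=> Hq.
have /fin_all_exists [p Hp] : forall j : 'I_(size q), exists p, forall g,
    ideal_pow m p g -> ideal_pow m (j + p).+1 (g * q`_j).
  by move=> j; case: (Hq j).
exists (\sum_(j < size q) (j + p j))%N => i r ib Hr.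
rewrite coefMr; apply: ideal_sum => // j _.
have [jq|jq] := ltnP j (size q); last by rewrite [q`_j]nth_default // mulr0; apply: ideal0.
pose j' := Ordinal jq.
have bnd : (j + p j' <= i)%N.
  by apply: leq_trans ib; rewrite (bigD1 j') //= leq_addr.
have [k [c [d [Hc [Hd ->]]]]] :
    ideal_mul (ideal_pow m (i - j - p j')) (ideal_pow m (p j')) r`_(i - j).
  by apply: ideal_powD => //; rewrite subnK //; lia.
rewrite mulr_suml; apply: ideal_sum => // l _; rewrite -mulrA.
have {1}-> : i.+1 = (i - j - p j' + (j + p j').+1)%N by lia.
by apply: ideal_powM => //; apply: (Hp j').
Qed.

End Rees.

(** Torsion pulls back to an ideal [T] of the noetherian cover. Each of its finitely many generators
    contributes nothing to the graded ring in large degrees. *)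
Lemma gr_torsion_bounded (R : comNzRingType) n (x : 'I_n -> R) : noetherian R ->
  exists c, forall i a, (c <= i)%N -> gr_torsion (gen_ideal x) i a ->
    ideal_pow (gen_ideal x) i.+1 a.
Proof.
move=> NR; set m := gen_ideal x.
have Hm : is_ideal m by apply: gen_ideal_ideal.
have HI k := ideal_pow_ideal k Hm.
pose cs := [seq (x i)%:P * 'X | i <- enum 'I_n].
have [|B [phi [NB Hphi HC Hcs]]] := @rees_noetherian_cover R m Hm cs NR.
  move=> _ /mapP[i _ ->] [|[|j]]; rewrite coefMX //=; last by rewrite coefC; exact: ideal0 (HI j.+2).
  rewrite coefC /= -[x i]mulr1; apply: ideal_mul_mem => //; exact: gen_ideal_mem.
(* Every homogeneous element [r X^d] of the Rees algebra comes from [B], because the generators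
   [x_i X] do. *)
have im d r : ideal_pow m d r -> exists b, phi b = r%:P * 'X^d.
  have im_ideal e : is_ideal (fun r => exists b, phi b = r%:P * 'X^e).
    split; first by exists 0; rewrite rmorph0 polyC0 mul0r.
      by move=> a b [c Ec] [c' Ec']; exists (c + c'); rewrite rmorphD Ec Ec' polyCD mulrDl.
    move=> a b [c Ec]; have [a' Ea] := HC a.
    by exists (a' * c); rewrite rmorphM Ec Ea polyCM mulrA.
  elim: d r => [|d IH] r; first by move=> _; have [b Eb] := HC r; exists b; rewrite mulr1.
  move: r; refine (ideal_mul_sub (im_ideal d.+1) _).
  move=> a b ma /IH [b' Eb].
  have [a' Ea] : exists b, phi b = a%:P * 'X^1.
    apply: (gen_ideal_sub (im_ideal 1%N) _ ma) => i; rewrite expr1.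
    by apply: Hcs; apply: map_f; rewrite mem_enum.
  by exists (a' * b'); rewrite rmorphM Ea Eb polyCM [in RHS]exprS expr1; ring.
pose T b := forall i, gr_torsion m i (phi b)`_i.
have HT : is_ideal T.
  have HG i := gr_torsion_ideal Hm i.
  split; first by move=> i; rewrite rmorph0 coef0; apply: ideal0.
    by move=> a b Ta Tb i; rewrite rmorphD coefD; apply: ideal_add.
  move=> r a Ta i; rewrite rmorphM coefM; apply: ideal_sum => // j _.
  have {1}-> : i = (j + (i - j))%N by rewrite subnKC // -ltnS.
  by apply: gr_torsionM => //; apply: Hphi.
have [k [q Hq]] := NB _ HT.
have /fin_all_exists [b Hb] : forall l : 'I_k, exists b, forall i (r : {poly R}),
    (b <= i)%N -> rees m r -> ideal_pow m i.+1 (r * phi (q l))`_i.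
  move=> l; apply: gr_torsion_poly_bound => //.
  by have : T (q l) by apply/Hq; apply: gen_ideal_mem.
exists (\max_l b l) => i a ib Ga.
have [u Eu] : exists b, phi b = a%:P * 'X^i by apply: im; case: Ga.
have Tu : T u.
  move=> j; rewrite Eu coefCM coefXn; case: eqP => [->|_]; first by rewrite mulr1.
  by rewrite mulr0; apply: ideal0; apply: gr_torsion_ideal.
have [c Ec] : gen_ideal q u by apply/Hq.
have -> : a = (phi u)`_i by rewrite Eu coefCM coefXn eqxx mulr1.
rewrite Ec rmorph_sum coef_sum; apply: ideal_sum => // l _; rewrite rmorphM.
by apply: Hb => //; apply: leq_trans ib; apply: leq_bigmax.
Qed.

(** * Extension to R[t] *)

Section ColengthMore.
Variables (A : comNzRingType) (P : A -> Prop).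
Hypothesis Pprime : is_prime P.

Lemma eq_colen J K : loc_sub P J K -> loc_sub P K J -> finite_colen P J ->
  colen P J = colen P K.
Proof.
move=> JK KJ FJ; have FK := finite_colen_sub Pprime JK FJ.
by apply/eqP; rewrite eqn_leq; apply/andP; split; apply: leq_colen.
Qed.

Lemma finite_colen_colon J z : is_ideal J ->
  finite_colen P (idealD J (principal z)) -> finite_colen P (colon J z) ->
  finite_colen P J.
Proof.
move=> HJ F1 F2.
exists (colen P (idealD J (principal z)) + colen P (colon J z)).+1 => H.
have [a [b [le_l /(colen_geP Pprime F1) Ha /(colen_geP Pprime F2) Hb]]] :=
  colen_ge_colon Pprime z HJ H.
by move: (leq_trans le_l (leq_add Ha Hb)); rewrite ltnn.
Qed.

Lemma loc_mem_prime J : is_ideal J -> loc_sub P P J -> ~ loc_mem P J 1 ->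
  finite_colen P J /\ colen P J = 1%N.
Proof.
move=> HJ PJ J1; have HL := loc_mem_ideal Pprime HJ.
have H2 : ~ colen_ge P 2 J.
  move=> H; apply: (colen_ge2N Pprime HL PJ).
  by apply: (colen_ge_mono Pprime _ H) => a.
split; first by exists 2.
apply: colen_eq => //; apply: NNPP => H; apply: J1; exact: colen_ge1.
Qed.

End ColengthMore.

Lemma maximal_prime (R : comNzRingType) (M : R -> Prop) : is_maximal M -> is_prime M.
Proof.
move=> [PM Mmax]; have [HM M1] := PM; split=> // a b Mab; apply: NNPP => nab.
have HD : is_ideal (idealD M (principal a)).
  by apply: idealD_ideal => //; apply: principal_ideal.
have [|E|[c [_ [Mc [d ->] E]]]] := Mmax _ HD.
- by apply: idealD_subl; apply: principal_ideal.
- apply: nab; left; apply/E; apply: idealD_subr => //.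
  by exists 1; rewrite mul1r.
apply: nab; right; rewrite -[b]mul1r E mulrDl; apply: ideal_add => //.
  exact: ideal_mulr.
by rewrite -mulrA; apply: ideal_mull.
Qed.

(** * Length over a local ring as local colength *)

Section LocalRing.
Variables (R : comNzRingType) (M : R -> Prop).
Hypotheses (NR : noetherian R) (HM : local_with_max M).
Let Mprime : is_prime M. Proof. by apply: maximal_prime; case: HM. Qed.

(** Elements outside [M] are units, so localizing at [M] changes no ideal. *)
Lemma loc_mem_local J a : is_ideal J -> loc_mem M J a -> J a.
Proof.
move=> HJ [s [/(local_unit NR HM) [b E] Jsa]].
by rewrite -[a]mul1r -E -mulrA; apply: ideal_mull.
Qed.

Lemma chain_colen_ge k J C : ideal_chain J k C -> colen_ge M k J.
Proof.
elim: k J C => [|k IH] J C [CI [JC Cs]] //.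
exists (C 1%N); split.
- exact: CI.
- by apply: loc_subW => // a Ja; have [H _] := Cs 0%N isT; apply: H; apply: JC.
- move=> C1J; have [_] := Cs 0%N isT; apply=> a /C1J Ha.
  apply: loc_mem_local; first exact: CI.
  by apply: loc_mem_trans Ha => //; apply: loc_subW.
apply: (IH _ (fun i => C i.+1)); split; first by move=> i ik; apply: CI.
by split=> // i ik; apply: Cs.
Qed.

Lemma colen_ge_chain k J : is_ideal J -> colen_ge M k J ->
  exists C, ideal_chain J k C.
Proof.
elim: k J => [|k IH] J HJ.
  by move=> _; exists (fun _ => J); split=> //; split=> // a.
move=> [K [HK JK nKJ /(IH K HK) [C [CI [KC Cs]]]]].
exists (fun i => if i is i'.+1 then C i' else J); split; first by case=> // i; apply: CI.
split; first by move=> a.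
case=> [_|i]; last exact: Cs.
split; first by move=> a /JK Ha; apply: KC; apply: loc_mem_local.
by move=> CJ; apply: nKJ; apply: loc_subW => // a /KC; apply: CJ.
Qed.

Lemma length_quot_colen J l : is_ideal J -> length_quot J l ->
  finite_colen M J /\ colen M J = l.
Proof.
move=> HJ [[C [HC _]] Hmax].
have H2 : ~ colen_ge M l.+1 J.
  by move=> /(colen_ge_chain HJ) [D /Hmax]; rewrite ltnn.
split; first by exists l.+1.
by apply: colen_eq => //; apply: chain_colen_ge HC.
Qed.

End LocalRing.

Section ExtPoly.
Variables (R : comNzRingType) (n : nat).
Implicit Types (J K : R -> Prop) (p q : {mpoly R[n]}).

Lemma ext_poly_ideal J : is_ideal J -> is_ideal (@ext_poly R n J).
Proof.
move=> HJ; split; first by move=> mo; rewrite mcoeff0; apply: ideal0.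
  by move=> p q Hp Hq mo; rewrite mcoeffD; apply: ideal_add.
by move=> p q Hq mo; rewrite mcoeffM; apply: ideal_sum => // k _; apply: ideal_mull.
Qed.

Lemma ext_polyM J K p q : is_ideal J -> is_ideal K ->
  ext_poly J p -> ext_poly K q -> ext_poly (ideal_mul J K) (p * q).
Proof.
move=> HJ HK Hp Hq mo; rewrite mcoeffM; apply: ideal_sum => [|k _].
  exact: ideal_mul_ideal.
exact: ideal_mul_mem.
Qed.

Lemma ext_polyC J c : is_ideal J -> J c -> @ext_poly R n J c%:MP.
Proof. by move=> HJ Jc mo; rewrite mcoeffC; apply: ideal_mulr. Qed.

Lemma ext_polyCE J c : @ext_poly R n J c%:MP -> J c.
Proof. by move/(_ 0%MM); rewrite mcoeffC eqxx mulr1. Qed.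

Lemma ext_poly_sub J (L : {mpoly R[n]} -> Prop) : is_ideal L ->
  (forall c, J c -> L c%:MP) -> subsetR (ext_poly J) L.
Proof.
move=> HL H p Hp; rewrite [p]mpolyE; apply: ideal_sum => // mo _.
by rewrite -mul_mpolyC; apply: ideal_mulr => //; apply: H.
Qed.

Lemma ext_poly_mono J K : subsetR J K -> subsetR (@ext_poly R n J) (ext_poly K).
Proof. by move=> JK p Hp mo; apply: JK. Qed.

Lemma ext_poly_pow_sub J l : is_ideal J ->
  subsetR (@ext_poly R n (ideal_pow J l)) (ideal_pow (ext_poly J) l).
Proof.
move=> HJ; have HE := ext_poly_ideal HJ.
apply: ext_poly_sub; first exact: ideal_pow_ideal.
elim: l => [|l IH] // c [k [a [b [Ja [Hb ->]]]]].
rewrite rmorph_sum; apply: ideal_sum => [|i _]; first exact: ideal_pow_ideal.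
rewrite /= mpolyCM; exact: (ideal_mul_mem (ext_polyC HJ (Ja i)) (IH _ (Hb i))).
Qed.

Lemma ext_poly_prime M : is_prime M -> is_prime (@ext_poly R n M).
Proof.
move=> [[HM M1] Mprime]; have HE := ext_poly_ideal HM.
split; first by split=> // H1; apply: M1; apply: ext_polyCE; rewrite mpolyC1; apply: H1.
(* [p0] keeps exactly the terms of [p] with coefficient outside [M]. Unless [p0] is zero its leading
   coefficient is outside [M], so primality is tested on a product of leading coefficients. *)
have reduce p : exists p0, ext_poly M (p - p0) /\ (forall mo, M p0@_mo -> p0@_mo = 0).
  pose E mo := if excluded_middle_informative (M p@_mo) then 0 else p@_mo.
  pose p0 : {mpoly R[n]} := \sum_(mo : 'X_{1..n < msize p}) E mo *: 'X_[mo].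
  have Ep0 mo : p0@_mo = E mo.
    have [lt_mo|ge_mo] := ltnP (mdeg mo) (msize p); first exact: mcoeff_mpoly.
    have -> : E mo = 0.
      by rewrite /E memN_msupp_eq0 ?msize_mdeg_ge //; case: excluded_middle_informative.
    rewrite raddf_sum big1 // => mo' _; rewrite /= mcoeffZ mcoeffX.
    case: eqP => [Emo|_]; last by rewrite mulr0.
    by move: ge_mo; rewrite -Emo leqNgt bmdeg.
  have Dp0 mo : (M p@_mo /\ p0@_mo = 0) \/ (~ M p@_mo /\ p0@_mo = p@_mo).
    by rewrite Ep0 /E; case: excluded_middle_informative => Hp; [left|right].
  exists p0; split=> mo; rewrite ?mcoeffB; have [[Mp ->]|[Mp ->]] // := Dp0 mo.
    by rewrite subr0.
  by rewrite subrr; apply: ideal0.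
move=> p q Hpq; apply: NNPP => Hn.
have [p0 [Hp Zp]] := reduce p; have [q0 [Hq Zq]] := reduce q.
have Hpq0 : ext_poly M (p0 * q0).
  have -> : p0 * q0 = p * q - p0 * (q - q0) - (p - p0) * q by ring.
  apply: (ideal_sub HE); last exact: (ideal_mulr _ HE).
  by apply: (ideal_sub HE) => //; apply: (ideal_mull _ HE).
have := Hpq0 (mlead p0 + mlead q0)%MM; rewrite mleadcM => /Mprime [/Zp|/Zq] /eqP;
  rewrite mleadc_eq0 => /eqP E0; apply: Hn; [left|right].
  by move: Hp; rewrite E0 subr0.
by move: Hq; rewrite E0 subr0.
Qed.

End ExtPoly.

(** * Invariance of colength under extension to R[t] *)

Section Transfer.
Variables (R : comNzRingType) (n : nat) (M : R -> Prop).
Hypothesis Mprime : is_prime M.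
Let HM : is_ideal M. Proof. by case: Mprime => -[]. Qed.
Let E := @ext_poly R n.
Let Eprime : is_prime (E M) := ext_poly_prime n Mprime.

Lemma loc_mem_ext J c : is_ideal J -> loc_mem M J c -> loc_mem (E M) (E J) c%:MP.
Proof.
move=> HJ [s [Ms Jsc]]; exists s%:MP; split; first by move=> /ext_polyCE.
by rewrite -mpolyCM; apply: ext_polyC.
Qed.

(** Induction on the colength. An [a] in [M] outside [J] splits the colength between [J + (a)] and
    [J : a], both strictly smaller, and extension commutes with both operations. If there is no such
    [a], then [J] is locally [M] or the unit ideal. *)
Lemma colen_ext J : is_ideal J -> finite_colen M J ->
  finite_colen (E M) (E J) /\ colen (E M) (E J) = colen M J.
Proof.
have [l] := ubnP (colen M J); elim: l J => // l IH J; rewrite ltnS => lJ HJ FJ.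
have HEJ := ext_poly_ideal n HJ.
have [[a [Ma Ja]]|Hno] := classic (exists a, M a /\ ~ loc_mem M J a); last first.
  have MJ : loc_sub M M J by move=> a Ma; apply: NNPP => Ja; apply: Hno; exists a.
  have EMJ : loc_sub (E M) (E M) (E J).
    apply: ext_poly_sub; first exact: loc_mem_ideal.
    by move=> c /MJ; apply: loc_mem_ext.
  have [J1|J1] := classic (loc_mem M J 1).
    have EJ1 : loc_mem (E M) (E J) 1 by apply: (loc_mem_ext HJ J1).
    rewrite (colen1 Mprime HJ J1) (colen1 Eprime HEJ EJ1); split=> //.
    by exists 1%N; apply: colen_ge1N.
  have [_ ->] := loc_mem_prime Mprime HJ MJ J1.
  apply: loc_mem_prime => // -[s [Ms]]; rewrite mulr1 => EJs; apply: Ms => mo.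
  apply: NNPP => Ms; apply: J1; exists s@_mo; split=> //.
  by rewrite mulr1.
have Ha := principal_ideal a.
have HD : is_ideal (idealD J (principal a)) by apply: idealD_ideal.
have HC := colon_ideal a HJ.
have FD : finite_colen M (idealD J (principal a)).
  by apply: finite_colen_sub FJ => //; apply: loc_subW => //; apply: idealD_subl.
have FC : finite_colen M (colon J a).
  by apply: finite_colen_sub FJ => //; apply: loc_subW => //; apply: colon_sub.
have Ecol := colen_colon Mprime a HJ FJ.
have D0 : (0 < colen M (idealD J (principal a)))%N.
  rewrite lt0n; apply/eqP => /(colen_eq0 Mprime HD FD) /(loc_nakayama1 Mprime HJ Ma) J1.
  by apply: Ja; apply: loc_mem1.
have C0 : (0 < colen M (colon J a))%N.
  rewrite lt0n; apply/eqP => /(colen_eq0 Mprime HC FC) J1; apply: Ja.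
  by rewrite -[a]mulr1; apply/loc_mem_colon.
have [|FED EED] := IH _ _ HD FD; first by lia.
have [|FEC EEC] := IH _ _ HC FC; first by lia.
have HaE := principal_ideal (a%:MP_[n]).
have HDE : is_ideal (idealD (E J) (principal a%:MP)) by apply: idealD_ideal.
have sub1 : subsetR (E (idealD J (principal a))) (idealD (E J) (principal a%:MP)).
  apply: ext_poly_sub => // c [b [_ [Jb [d ->] ->]]]; rewrite mpolyCD mpolyCM.
  by exists b%:MP, (d%:MP * a%:MP); split=> //; [apply: ext_polyC|exists d%:MP].
have sub2 : subsetR (idealD (E J) (principal a%:MP)) (E (idealD J (principal a))).
  apply: idealD_sub; first exact: ext_poly_ideal.
    by apply: ext_poly_mono; apply: idealD_subl.
  move=> _ [p ->]; apply: ideal_mull (ext_poly_ideal n HD) _.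
  apply: ext_polyC => //; apply: idealD_subr => //; by exists 1; rewrite mul1r.
have subC1 : subsetR (E (colon J a)) (colon (E J) a%:MP).
  by move=> p Hp mo; rewrite mcoeffCM; apply: Hp.
have subC2 : subsetR (colon (E J) a%:MP) (E (colon J a)).
  by move=> p Hp mo; move: (Hp mo); rewrite mcoeffCM.
have F1 : finite_colen (E M) (idealD (E J) (principal a%:MP)).
  by apply: finite_colen_sub FED => //; apply: loc_subW.
have F2 : finite_colen (E M) (colon (E J) a%:MP).
  by apply: finite_colen_sub FEC => //; apply: loc_subW.
have FE := finite_colen_colon Eprime HEJ F1 F2; split=> //.
rewrite (colen_colon Eprime a%:MP HEJ FE) Ecol -EED -EEC.
by congr (_ + _)%N; apply: eq_colen => //; apply: loc_subW.
Qed.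

End Transfer.

(** * The generic linear form *)

Section GenericLinearForm.
Variables (R : comNzRingType) (n : nat) (x : 'I_n -> R).
Let m := gen_ideal x.
Let Hm : is_ideal m := gen_ideal_ideal x.
Let HI k : is_ideal (ideal_pow m k) := ideal_pow_ideal k Hm.

Lemma ideal_pow_words k (L : R -> Prop) : is_ideal L ->
  (forall w : seq 'I_n, size w = k -> L (\prod_(j <- w) x j)) ->
  subsetR (ideal_pow m k) L.
Proof.
elim: k L => [|k IH] L HL Hw a.
  by move=> _; rewrite -[a]mulr1; apply: ideal_mull => //; have := Hw [::] erefl; rewrite big_nil.
move: a; refine (ideal_mul_sub HL _) => a b ma; move: b.
suff : subsetR m (fun a => forall b, ideal_pow m k b -> L (a * b)) by apply.
apply: gen_ideal_sub.
  split.
  - by move=> b _; rewrite mul0r; apply: ideal0.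
  - by move=> c d Hc Hd b Hb; rewrite mulrDl; apply: ideal_add; [|apply: Hc|apply: Hd].
  - by move=> r c Hc b Hb; rewrite -mulrA; apply: ideal_mull => //; apply: Hc.
move=> j; apply: (IH (colon L (x j))); first exact: colon_ideal.
by move=> w sw; have := Hw (j :: w); rewrite big_cons; apply; rewrite /= sw.
Qed.

Lemma words_ideal_pow (w : seq 'I_n) : ideal_pow m (size w) (\prod_(j <- w) x j).
Proof.
elim: w => [|j w IH] //; rewrite big_cons; exact: (ideal_mul_mem (gen_ideal_mem x j) IH).
Qed.

Lemma size_sum_count (w : seq 'I_n) : size w = (\sum_(j < n) count_mem j w)%N.
Proof.
elim: w => [|i w IH] /=; first by rewrite big1.
rewrite IH big_split /= -add1n; congr (_ + _)%N.
rewrite (bigD1 i) //= eqxx big1 ?addn0 // => j ji.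
by rewrite eq_sym (negbTE ji).
Qed.

(* A word longer than [n * p] contains some letter at least [p] times. *)
Lemma ideal_pow_pigeonhole p k (L : R -> Prop) : (n * p < k)%N -> is_ideal L ->
  (forall j h, ideal_pow m (k - p) h -> L (x j ^+ p * h)) ->
  subsetR (ideal_pow m k) L.
Proof.
move=> npk HL Hj; apply: ideal_pow_words => // w sw.
have [j pj] : exists j, (p <= count_mem j w)%N.
  apply: NNPP => Hn; move: npk; rewrite -sw size_sum_count ltnNge => /negP; apply.
  rewrite -[X in (_ <= X * _)%N]card_ord -sum_nat_const; apply: leq_sum => j _.
  by apply: ltnW; rewrite ltnNge; apply/negP => Hp; apply: Hn; exists j.
pose v := [seq i <- w | predC (pred1 j) i].
have Ew : \prod_(i <- w) x i = x j ^+ p * (x j ^+ (count_mem j w - p) * \prod_(i <- v) x i).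
  rewrite mulrA -exprD subnKC //.
  have /permPl Hp := perm_filterC (pred1 j) w.
  rewrite -(perm_big _ Hp) big_cat /=; congr (_ * _).
  rewrite -size_filter; elim: w {v sw pj Hp} => [|i w IH] /=; first by rewrite big_nil.
  by case: eqP => [->|] //=; rewrite big_cons IH exprS.
rewrite Ew; apply: Hj.
have -> : (k - p = (count_mem j w - p) + size v)%N.
  have : (count_mem j w + size v = k)%N by rewrite size_filter count_predC.
  by move: pj; clear; lia.
apply: ideal_powM => //; last exact: words_ideal_pow.
by apply: ideal_powX; apply: gen_ideal_mem.
Qed.

Lemma zgen_coef (f : {mpoly R[n]}) (be : 'X_{1..n}) :
  (zgen x * f)@_be = \sum_(i < n) x i * (if be i == 0%N then 0 else f@_(be - U_(i))%MM).
Proof.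
rewrite /zgen mulr_suml raddf_sum; apply: eq_bigr => i _ /=.
rewrite -mulrA mcoeffCM; congr (_ * _); rewrite mulrC.
case: eqP => [b0|/eqP b0].
  rewrite mcoeffMr big1 // => k /eqP Ek; rewrite mcoeffX.
  case: eqP => [Ei|_]; last by rewrite mulr0.
  by move: b0; rewrite {1}Ek mnmDE -Ei mnm1E eqxx; lia.
have Eb : be = (U_(i) + (be - U_(i)))%MM by rewrite addmC submK // lep1mP.
by rewrite {1}Eb mcoeffMX.
Qed.

(* Multiplying by z trades one power of x_j on a coefficient of f for a unit of
   degree in t_j; iterating beyond the degree of f kills the coefficient. *)
Lemma zgen_coef_power i (f : {mpoly R[n]}) j p (al : 'X_{1..n}) :
  ext_poly (ideal_pow m i.+2) (zgen x * f) -> (msize f <= al j + p)%N ->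
  ideal_pow m (i + p).+1 (x j ^+ p * f@_al).
Proof.
move=> Hzf; elim: p al => [|p IH] al Hp.
  rewrite memN_msupp_eq0 ?mulr0; first exact: ideal0 (HI _).
  apply: msize_mdeg_ge; apply: leq_trans Hp _.
  by rewrite addn0 mdegE (bigD1 j) //= leq_addr.
have := Hzf (al + U_(j))%MM; rewrite zgen_coef (bigD1 j) //=.
rewrite mnmDE mnm1E eqxx addn1 /= addmK => Hj.
set S := \sum_(i0 < n | i0 != j) _ in Hj.
have -> : x j ^+ p.+1 * f@_al = x j ^+ p * (x j * f@_al + S) - x j ^+ p * S.
  by rewrite exprSr; ring.
apply: (ideal_sub (HI (i + p.+1).+1)).
  have -> : (i + p.+1).+1 = (p + i.+2)%N by lia.
  by apply: ideal_powM => //; apply: ideal_powX; apply: gen_ideal_mem.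
rewrite mulr_sumr; apply: ideal_sum => // l lj; rewrite mulrCA.
case: ifP => _; first by rewrite !mulr0; apply: ideal0.
rewrite addnS; apply: (ideal_mul_mem (gen_ideal_mem x l)).
by apply: IH; rewrite mnmBE mnmDE !mnm1E eqxx (negbTE lj); move: Hp; clear; lia.
Qed.

(** With [p = msize f], each [x_j^p] kills the class of every coefficient of [f]. A power of [m]
    with exponent above [n * p] is generated by multiples of the [x_j^p], so it kills them as
    well. *)
Lemma zgen_gr_torsion i (f : {mpoly R[n]}) al :
  ext_poly (ideal_pow m i) f -> ext_poly (ideal_pow m i.+2) (zgen x * f) ->
  gr_torsion m i f@_al.
Proof.
move=> Hf Hzf; split; first exact: Hf.
pose k := (n * msize f).+1; pose L := colon (ideal_pow m (i + k).+1) f@_al.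
exists k => g Hg; rewrite mulrC.
suff : subsetR (ideal_pow m k) L by apply.
apply: (@ideal_pow_pigeonhole (msize f)) => //; first exact: colon_ideal (HI _).
move=> j h Hh; rewrite /L /colon.
have -> : f@_al * (x j ^+ msize f * h) = h * (x j ^+ msize f * f@_al)
  by rewrite mulrCA [_ * h]mulrC mulrCA.
have n0 : (0 < n)%N by case: j {Hzf} => j /=; apply: leq_trans.
have -> : (i + k).+1 =
    ((n * msize f).+1 - msize f + (i + msize f).+1)%N.
  have : (msize f <= n * msize f)%N by rewrite leq_pmull.
  by rewrite /k; clear; lia.
apply: ideal_powM => //; apply: zgen_coef_power => //; exact: leq_addl.
Qed.

(** Multiplication by the initial form of [z] is injective on the graded ring with the variables [t]
    adjoined, in degrees [i >= c]: its kernel is torsion, and torsion vanishes there. *)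
Lemma zgen_superficial : noetherian R -> exists c, forall i (f : {mpoly R[n]}),
  (c <= i)%N -> ext_poly (ideal_pow m i) f ->
  ext_poly (ideal_pow m i.+2) (zgen x * f) -> ext_poly (ideal_pow m i.+1) f.
Proof.
move=> NR; have [c Hc] := gr_torsion_bounded x NR; exists c => i f ci Hf Hzf al.
by apply: Hc => //; apply: zgen_gr_torsion.
Qed.

Lemma zgen_ext : ext_poly m (zgen x).
Proof.
have HE := ext_poly_ideal n Hm.
apply: ideal_sum => // i _; apply: (ideal_mulr _ HE).
by apply: ext_polyC => //; apply: gen_ideal_mem.
Qed.

End GenericLinearForm.

(** * Counting under a staircase *)

(** Every index before the first success is a failure. Since any predicate is allowed, column
    heights get bounded without proving that the rows decrease. *)
Lemma find_iota_leq_sum (p : pred nat) M :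
  (find p (iota 0 M) <= \sum_(i < M) ~~ p i)%N.
Proof.
rewrite -(big_mkord xpredT (fun i => nat_of_bool (~~ p i))) /index_iota subn0.
elim: (iota 0 M) => [|i s IH] //=; rewrite big_cons.
by case: (p i) => //=; rewrite add1n ltnS.
Qed.

Lemma sum_ltn_leq M T : (\sum_(i < M) (i < T) <= T)%N.
Proof.
suff : (\sum_(i < M) (i < T) <= minn M T)%N by rewrite leq_min => /andP[].
elim: M => [|M IH]; first by rewrite big_ord0.
rewrite big_ord_recr /=; move: IH; set S := (\sum_(i < M) _)%N; move: S => S.
by case: (ltnP M T) => MT; lia.
Qed.

Lemma sum_shift (c : nat -> nat) M :
  (\sum_(j < M) c j.+1 + c 0 = \sum_(j < M) c j + c M)%N.
Proof.
elim: M => [|M IH]; first by rewrite !big_ord0.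
by rewrite !big_ord_recr /= addnAC IH.
Qed.

Lemma double_sum_ord n : (2 * \sum_(t < n) t = n * n.-1)%N.
Proof.
elim: n => [|n IH]; first by rewrite big_ord0.
by rewrite big_ord_recr /= mulnDr IH; case: n {IH} => //= n; nia.
Qed.

Lemma double_sum_rev_ord n : (2 * \sum_(t < n) (n - t) = n * n.+1)%N.
Proof.
elim: n => [|n IH]; first by rewrite big_ord0.
rewrite big_ord_recl /= (eq_bigr (fun t : 'I_n => n - t)%N) // mulnDr IH subn0.
nia.
Qed.

Lemma sum_divn_modn (f : nat -> nat -> nat) q n :
  (\sum_(a < q * n) f (a %/ n) (a %% n) = \sum_(j < q) \sum_(t < n) f j t)%N.
Proof.
elim: q => [|q IH]; first by rewrite !big_ord0.
rewrite big_ord_recr /= -IH.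
have -> : (q.+1 * n = q * n + n)%N by rewrite mulSn addnC.
rewrite big_split_ord /=; congr (_ + _)%N; apply: eq_bigr => t _.
have n0 : (0 < n)%N by apply: leq_trans (ltn_ord t).
by rewrite divnMDl // modnMDl divn_small // modn_small // addn0.
Qed.

Section Staircase.
Variables (l : nat -> nat) (r : nat).
Hypotheses (r0 : (0 < r)%N)
  (l_gt : forall k, (k < r)%N -> (0 < l k)%N).

(* Column heights of the staircase with row lengths l_0, ..., l_(r-1). *)
Definition column j := find (fun k => (l k <= j)%N) (iota 0 r).

(* Abscissa, on the n-th dilate of the polygon through the points
   (column j, j), of its point at height a. *)
Definition dilated_column n a :=
  ((a %% n) * column (a %/ n).+1 + (n - a %% n) * column (a %/ n))%N.

Lemma column0 : column 0 = r.
Proof.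
have /hasPn/hasNfind : forall k, k \in iota 0 r -> ~~ (l k <= 0)%N.
  by move=> k; rewrite mem_iota -ltnNge => /l_gt.
by rewrite /column size_iota.
Qed.

Lemma column_last : column (l 0) = 0%N.
Proof. by rewrite /column; case: r r0 => //= r' _; rewrite leqnn. Qed.

Lemma columnP j : column j = r \/ (l (column j) <= j)%N.
Proof.
have [Hh|Hh] := boolP (has (fun k => (l k <= j)%N) (iota 0 r)).
  right; have := nth_find 0%N Hh; rewrite nth_iota ?add0n //.
  by rewrite has_find size_iota in Hh.
by left; rewrite /column hasNfind // size_iota.
Qed.

(** The cells [(k, j)] with [j < l k] are counted by columns and then by rows. *)
Lemma sum_column : (\sum_(j < l 0) column j <= \sum_(k < r) l k)%N.
Proof.
apply: (@leq_trans (\sum_(j < l 0) \sum_(k < r) ~~ (l k <= j))).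
  by apply: leq_sum => j _; apply: find_iota_leq_sum.
rewrite exchange_big; apply: leq_sum => k _.
rewrite (eq_bigr (fun j : 'I_(l 0) => (j < l k)%N : nat)) ?sum_ltn_leq //.
by move=> j _; rewrite -ltnNge.
Qed.

(** Trapezoid rule: the strip between heights [j] and [j + 1] contributes [n(n-1)/2] times
    [column j.+1] plus [n(n+1)/2] times [column j]. The shifted sum of columns is smaller by
    [column 0 = r], whence the term [n(n-1) r]. *)
Lemma sum_dilated_column n :
  (2 * \sum_(a < l 0 * n) dilated_column n a + n * n.-1 * r
    <= 2 * (n * n * \sum_(k < r) l k))%N.
Proof.
rewrite /dilated_column
  (sum_divn_modn (fun j t => t * column j.+1 + (n - t) * column j)%N).
have E j : (2 * \sum_(t < n) (t * column j.+1 + (n - t) * column j)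
    = n * n.-1 * column j.+1 + n * n.+1 * column j)%N.
  by rewrite big_split /= -!big_distrl /= mulnDr !mulnA double_sum_ord double_sum_rev_ord.
have S1 : (\sum_(j < l 0) column j.+1 + r = \sum_(j < l 0) column j)%N.
  by have := sum_shift column (l 0); rewrite column0 column_last addn0.
rewrite big_distrr /= (eq_bigr _ (fun (j : 'I_(l 0)) _ => E j)) big_split /= -!big_distrr /=.
have := sum_column; move: S1.
set S := (\sum_(j < l 0) column j)%N; set S' := (\sum_(j < l 0) column j.+1)%N.
case: n {E} => [|n] ESr HS //=.
have -> : (n.+1 * n * S' + n.+1 * n.+2 * S + n.+1 * n * r = 2 * (n.+1 * n.+1 * S))%N.
  by rewrite addnAC -mulnDr ESr; nia.
by rewrite !leq_mul2l HS !orbT.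
Qed.

End Staircase.

(** * Colength of powers *)

Section Filtration.
Variables (R : comNzRingType) (n : nat) (x : 'I_n -> R).
Local Notation M := (gen_ideal x).
Hypothesis Mprime : is_prime M.
Let E := @ext_poly R n.
Let P := E M.
Let z := zgen x.
Let HM : is_ideal M := gen_ideal_ideal x.
Let Eprime : is_prime P := ext_poly_prime n Mprime.
Let HMk k : is_ideal (ideal_pow M k) := ideal_pow_ideal k HM.
Let Hz : is_ideal (principal z) := principal_ideal z.

(* The preimage in A of the ideal (J : z^k)(A/z). *)
Definition slice (J : {mpoly R[n]} -> Prop) k : {mpoly R[n]} -> Prop :=
  idealD (colon J (z ^+ k)) (principal z).

Lemma slice_ideal J k : is_ideal J -> is_ideal (slice J k).
Proof. by move=> HJ; apply: idealD_ideal => //; apply: colon_ideal. Qed.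

(* Modulo higher powers of z, J contains z^k m^a. *)
Definition reaches (J : {mpoly R[n]} -> Prop) k a :=
  loc_sub P (E (ideal_pow M a)) (slice J k).

Lemma reaches_le J k k' a : is_ideal J -> (k <= k')%N ->
  reaches J k a -> reaches J k' a.
Proof.
move=> HJ /subnKC <- H; apply: (loc_sub_trans Eprime H); apply: loc_subW => //.
apply: idealD_sub; first exact: slice_ideal.
  move=> p Hp; apply: idealD_subl => //.
  by rewrite /colon exprD mulrAC; apply: ideal_mulr.
by apply: idealD_subr; apply: colon_ideal.
Qed.

(** From [s f = u + w z] and [t g = v + w' z], the product [s t f g] is [u v] plus a multiple of
    [z], and [z^(k+l) u v] lies in the product ideal. *)
Lemma reachesM (J K : R -> Prop) k a l b : is_ideal J -> is_ideal K ->
  reaches (E J) k a -> reaches (E K) l b ->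
  reaches (E (ideal_mul J K)) (k + l) (a + b).
Proof.
move=> HJ HK Fa Fb; have HJK := ext_poly_ideal n (ideal_mul_ideal HJ HK).
have HS := loc_mem_ideal Eprime (slice_ideal (k + l) HJK).
apply: ext_poly_sub => // c /(ideal_powD HM) [q [f [g [Hf [Hg ->]]]]].
rewrite rmorph_sum; apply: ideal_sum => // i _; rewrite /= mpolyCM.
have [s [Ps [u [_ [Hu [w ->] Eu]]]]] := Fa _ (ext_polyC (n:=n) (HMk a) (Hf i)).
have [t [Pt [v [_ [Hv [w' ->] Ev]]]]] := Fb _ (ext_polyC (n:=n) (HMk b) (Hg i)).
exists (s * t); split.
  by move=> Pst; case: Eprime => _ /(_ _ _ Pst) [].
exists (u * v), ((u * w' + w * v + w * w' * z) * z); split.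
- rewrite /colon exprD.
  have -> : z ^+ k * z ^+ l * (u * v) = (z ^+ k * u) * (z ^+ l * v) by rewrite mulrACA.
  exact: ext_polyM.
- by eexists.
- by rewrite mulrACA Eu Ev; ring.
Qed.

Lemma reaches_iter (I : R -> Prop) k a u s k' a' : is_ideal I ->
  reaches (E I) k a -> reaches (E (ideal_pow I s)) k' a' ->
  reaches (E (ideal_pow I (u + s))) (u * k + k') (u * a + a').
Proof.
move=> HI Fa Fb; elim: u => [|u IH] //.
rewrite !mulSn -!addnA addSn; apply: reachesM => //; exact: ideal_pow_ideal.
Qed.

Lemma reaches0 : reaches (E (@whole R)) 0 0.
Proof. by apply: loc_subW => // p _; apply: idealD_subl. Qed.

Lemma reaches_combine (I : R -> Prop) k a k' a' t s : is_ideal I ->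
  reaches (E I) k a -> reaches (E I) k' a' ->
  reaches (E (ideal_pow I (t + s))) (t * k + s * k') (t * a + s * a').
Proof.
move=> HI Fa Fb; apply: reaches_iter => //.
by have := reaches_iter (u := s) (s := 0%N) HI Fb reaches0; rewrite !addn0.
Qed.

Lemma reaches_colen J k a : is_ideal J -> finite_colen P J ->
  (colen P (slice J k) <= a)%N -> reaches J k a.
Proof.
move=> HJ FJ Ha; have HS := slice_ideal k HJ.
have FS : finite_colen P (slice J k).
  apply: finite_colen_sub FJ => //; apply: loc_subW => // p Jp.
  by apply: idealD_subl => //; apply: ideal_mull.
apply: (@loc_sub_trans _ _ Eprime _ (ideal_pow P a)).
  by apply: loc_subW => //; apply: ext_poly_pow_sub.
apply: ideal_pow_loc_sub => // /(colen_geP Eprime FS); by rewrite ltnNge Ha.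
Qed.

Lemma colen_slices J K : is_ideal J -> finite_colen P J ->
  colen P J = (\sum_(k < K) colen P (slice J k) + colen P (colon J (z ^+ K)))%N.
Proof.
move=> HJ FJ; elim: K => [|K IH].
  rewrite big_ord0 expr0; apply: eq_colen => //; apply: loc_subW => // p;
    by rewrite /colon mul1r.
rewrite big_ord_recr /= IH -addnA; congr (_ + _)%N.
have HC := colon_ideal (z ^+ K) HJ.
have FC : finite_colen P (colon J (z ^+ K)).
  by apply: finite_colen_sub FJ => //; apply: loc_subW => //; apply: colon_sub.
rewrite (colen_colon Eprime z HC FC); congr (_ + _)%N.
apply: eq_colen => //.
- by apply: loc_subW => // p; rewrite /colon exprSr mulrA.
- by apply: loc_subW => // p; rewrite /colon exprSr mulrA.
- by apply: finite_colen_sub FC => //; apply: loc_subW => //; apply: colon_sub.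
Qed.

(** * Counting on dilates of the polygon *)

Section Dilation.
Variables (I : R -> Prop) (r e C : nat).
Hypotheses (HI : is_ideal I) (FI : finite_colen P (E I)).
Hypothesis rP : loc_mem P (E I) (z ^+ r).
Hypothesis r_min : forall k, (k < r)%N -> ~ loc_mem P (E I) (z ^+ k).
Hypothesis r_gt0 : (0 < r)%N.
Hypothesis sC : forall a, finite_colen P (E (ideal_pow M a)) /\
  (colen P (idealD (E (ideal_pow M a)) (principal z)) <= e * a + C)%N.

Let HEI : is_ideal (E I) := ext_poly_ideal n HI.
Let l k := colen P (slice (E I) k).

Lemma finite_slice k : finite_colen P (slice (E I) k).
Proof.
apply: finite_colen_sub FI => //; apply: loc_subW => // p Jp.
by apply: idealD_subl => //; apply: (ideal_mull _ HEI).
Qed.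

Lemma slice_le0 k : (l k <= l 0)%N.
Proof.
apply: leq_colen => //; last exact: finite_slice.
apply: loc_subW => //; apply: idealD_sub; first exact: slice_ideal.
  move=> p; rewrite /colon expr0 mul1r => Ip; apply: idealD_subl => //.
  exact: (ideal_mull _ HEI).
by apply: idealD_subr; apply: colon_ideal.
Qed.

(** If the slice were the unit ideal, Nakayama would discard [z] and leave [z^k] in [I], against the
    minimality of [r]. *)
Lemma slice_gt0 k : (k < r)%N -> (0 < l k)%N.
Proof.
move=> kr; rewrite lt0n; apply/eqP => l0; apply: (r_min kr).
rewrite -[z ^+ k]mulr1; apply/loc_mem_colon.
apply: (loc_nakayama1 Eprime (colon_ideal _ HEI) (zgen_ext x)).
by apply: (colen_eq0 Eprime (slice_ideal k HEI) (finite_slice k)).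
Qed.

Lemma colen_sum_slices : colen P (E I) = (\sum_(k < r) l k)%N.
Proof.
rewrite (colen_slices r HEI FI) (colen1 Eprime (J := colon _ _)) ?addn0 //.
  exact: colon_ideal.
by apply/loc_mem_colon; rewrite mulr1.
Qed.

Lemma reaches_r a : reaches (E I) r a.
Proof.
move=> p _; apply: (loc_mem_trans Eprime (J := colon (E I) (z ^+ r))).
  by apply: loc_subW => //; apply: idealD_subl.
apply/loc_mem_colon; apply: ideal_mulr => //; exact: loc_mem_ideal.
Qed.

Lemma reaches_column j : reaches (E I) (column l r j) j.
Proof.
have [->|Hj] := columnP l r j; first exact: reaches_r.
exact: reaches_colen.
Qed.

(** Write [a = q N + t]. Taking [t] factors at height [q + 1] and [N - t] at height [q] gives total
    height [t (q+1) + (N-t) q = a]. *)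
Lemma reaches_dilated N a : (a < l 0 * N)%N ->
  reaches (E (ideal_pow I N)) (dilated_column l r N a) a.
Proof.
move=> aN; have N0 : (0 < N)%N by move: aN; case: N => //; rewrite muln0.
have tN : (a %% N < N)%N by rewrite ltn_mod.
have := reaches_combine (t := a %% N) (s := N - a %% N) HI
  (@reaches_column (a %/ N).+1) (@reaches_column (a %/ N)).
rewrite subnKC ?(ltnW tN) // /dilated_column.
suff -> : (a %% N * (a %/ N).+1 + (N - a %% N) * (a %/ N) = a)%N by [].
have := divn_eq a N; move: tN; set t := (a %% N)%N; set q := (a %/ N)%N.
by move=> tN ->; rewrite mulnS mulnBl [(q * N)%N]mulnC; nia.
Qed.

(** The error [C] is paid once for each of the [N r] slices, hence only linearly in [N]; the
    quadratic terms carry the area of the polygon. *)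
Lemma colen_ideal_pow N : finite_colen P (E (ideal_pow I N)) ->
  (2 * colen P (E (ideal_pow I N)) + e * (N * N.-1 * r)
    <= e * (2 * (N * N * colen P (E I))) + 2 * (C * (N * r)))%N.
Proof.
move=> FN; have HIN := ext_poly_ideal n (ideal_pow_ideal N HI).
(* Row lengths of the dilated polygon. If no height qualifies, [find] returns [l 0 * N], which is
   covered by the top vertex, where the column is zero. *)
pose h K := find (fun a => dilated_column l r N a <= K)%N (iota 0 (l 0 * N)).
have Fh K : reaches (E (ideal_pow I N)) K (h K).
  rewrite /h; set p := fun _ => _.
  have [Hh|Hh] := boolP (has p (iota 0 (l 0 * N))).
    have lt_h : (find p (iota 0 (l 0 * N)) < l 0 * N)%N.
      by rewrite has_find size_iota in Hh.
    have := nth_find 0%N Hh; rewrite nth_iota // add0n => HK.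
    by apply: (reaches_le HIN HK); apply: reaches_dilated.
  rewrite hasNfind // size_iota.
  have := reaches_combine (t := N) (s := 0%N) HI (@reaches_column (l 0)) (@reaches_column (l 0)).
  rewrite addn0 !mul0n !addn0 column_last // muln0 mulnC.
  by apply: reaches_le.
have HNr : reaches (E (ideal_pow I N)) (N * r) 0.
  have := reaches_combine (t := N) (s := 0%N) HI (@reaches_r 0) (@reaches_r 0).
  by rewrite addn0 !mul0n !addn0 muln0.
(* The sum over slices may stop at [N r]: there the slice is the unit ideal, and Nakayama removes
   [z] from it. *)
have lst : colen P (colon (E (ideal_pow I N)) (z ^+ (N * r))) = 0%N.
  apply: colen1 => //; first exact: colon_ideal.
  apply: (loc_nakayama1 Eprime (colon_ideal _ HIN) (zgen_ext x)).
  by apply: HNr.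
have step K : (colen P (slice (E (ideal_pow I N)) K) <= e * h K + C)%N.
  have [Fa Ha] := sC (h K); apply: leq_trans Ha; apply: leq_colen => //.
    apply: (idealD_loc_sub Eprime (slice_ideal K HIN) (@Fh K)).
    by apply: loc_subW => //; apply: idealD_subr; apply: colon_ideal.
  apply: finite_colen_sub Fa => //; apply: loc_subW => //; exact: idealD_subl.
have sumh : (\sum_(K < N * r) h K <= \sum_(a < l 0 * N) dilated_column l r N a)%N.
  apply: (@leq_trans (\sum_(K < N * r) \sum_(a < l 0 * N) ~~ (dilated_column l r N a <= K))).
    by apply: leq_sum => K _; apply: find_iota_leq_sum.
  rewrite exchange_big; apply: leq_sum => a _.
  rewrite (eq_bigr (fun K : 'I_(N * r) => (K < dilated_column l r N a)%N : nat)) ?sum_ltn_leq //.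
  by move=> K _; rewrite -ltnNge.
have bound : (colen P (E (ideal_pow I N)) <=
    e * \sum_(a < l 0 * N) dilated_column l r N a + C * (N * r))%N.
  rewrite (colen_slices (N * r) HIN FN) lst addn0.
  apply: (@leq_trans (\sum_(K < N * r) (e * h K + C))); first by apply: leq_sum.
  rewrite big_split /= sum_nat_const card_ord -big_distrr /= mulnC [(C * _)%N]mulnC.
  by rewrite leq_add2r mulnC leq_mul2l sumh orbT.
have := sum_dilated_column r_gt0 slice_gt0 N.
rewrite -colen_sum_slices; move: bound.
set S := (\sum_(a < _) _)%N; set c := colen _ _; set d := colen _ _.
move=> bound HS; have : (e * (2 * S + N * N.-1 * r) <= e * (2 * (N * N * d)))%N.
  by rewrite leq_mul2l HS orbT.
by rewrite mulnDr; move: bound; clear; nia.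
Qed.

End Dilation.
End Filtration.

(** * The bound from m-fullness *)

(** [L n.+1 - L n] equals [e n + e/2 + a]; a bound for [|a|] plus [e] absorbs the constant part in
    both directions. *)
Lemma quadratic_increment (L : nat -> nat) (e : nat) (a b : rat) n0 :
  (forall n, (n0 <= n)%N ->
     (L n)%:R = (e%:R / 2%:R) * n%:R ^+ 2 + a * n%:R + b :> rat) ->
  exists q, forall n, (n0 <= n)%N ->
    (L n.+1 <= L n + e * n.+1 + q)%N /\ (L n + e * n <= L n.+1 + q)%N.
Proof.
move=> HL; exists (Num.bound `|a| + e)%N => n nn0.
have := HL n nn0; have := HL n.+1 (leqW nn0).
have := archi_boundP (normr_ge0 a); set q := (Num.bound _)%:R.
have := ler_norm a; have := ler_norm (- a); rewrite normrN.
have e0 : 0 <= e%:R :> rat by exact: ler0n.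
rewrite -!(ler_nat rat) !natrD !natrM -natr1.
move: e0; set e' := e%:R; set L1 := (L n.+1)%:R; set L0 := (L n)%:R; set m := n%:R.
move=> e0 h1 h2 h3 E1 E0.
have D : L1 - L0 = e' * m + e' / 2 + a by rewrite E1 E0; field.
by split; lra.
Qed.

Lemma quadratic_le0 (u v w : rat) n0 :
  (forall n, (n0 <= n)%N -> u * n%:R ^+ 2 <= v * n%:R + w) -> u <= 0.
Proof.
move=> H; rewrite leNgt; apply/negP => u0.
pose q := (`|v| + `|w|) / u.
have q0 : 0 <= q by rewrite divr_ge0 ?addr_ge0 // ltW.
pose n := (Num.bound q + n0).+1.
have := H n (leqW (leq_addl _ _)); apply/negP; rewrite -ltNge.
have n1 : 1 <= n%:R :> rat by rewrite ler1n.
have qn : q < n%:R.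
  apply: lt_le_trans (archi_boundP q0) _; rewrite ler_nat; apply: leqW; exact: leq_addr.
have : `|v| + `|w| < n%:R * u by rewrite -ltr_pdivrMr.
have := ler_norm v; have := ler_norm w; have := normr_ge0 v; have := normr_ge0 w.
set N := n%:R in n1 *; set V := `|v|; set W := `|w|; rewrite expr2 => w0 v0 ww vv h.
have : (V + W) * N < N * u * N by rewrite ltr_pM2r //; lra.
by nra.
Qed.

Section MFull.
Variables (R : comNzRingType) (n : nat) (x : 'I_n -> R).
Local Notation M := (gen_ideal x).
Hypotheses (NR : noetherian R) (LR : local_with_max M).
Let E := @ext_poly R n.
Let P := E M.
Let z := zgen x.
Let HM : is_ideal M := gen_ideal_ideal x.
Let Mprime : is_prime M. Proof. by apply: maximal_prime; case: LR. Qed.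
Let Eprime : is_prime P := ext_poly_prime n Mprime.
Let HMk k : is_ideal (ideal_pow M k) := ideal_pow_ideal k HM.
Let Hz : is_ideal (principal z) := principal_ideal z.

Lemma length_quot_ext J l : is_ideal J -> length_quot J l ->
  finite_colen P (E J) /\ colen P (E J) = l.
Proof.
move=> HJ /(length_quot_colen NR LR HJ) [F <-].
exact: (colen_ext n Mprime HJ F).
Qed.

Variables (L : nat -> nat) (eR : nat) (a b : rat) (n0 : nat).
Hypothesis HL : forall k, length_quot (ideal_pow M k) (L k).
Hypothesis Lpoly : forall k, (n0 <= k)%N ->
  (L k)%:R = (eR%:R / 2%:R) * k%:R ^+ 2 + a * k%:R + b :> rat.

Let FM k : finite_colen P (E (ideal_pow M k)).
Proof. by case: (length_quot_ext (HMk k) (HL k)). Qed.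
Let cM k : colen P (E (ideal_pow M k)) = L k.
Proof. by case: (length_quot_ext (HMk k) (HL k)). Qed.
Let HEk k : is_ideal (E (ideal_pow M k)) := ext_poly_ideal n (HMk k).

Lemma pow_sub_colon k : subsetR (E (ideal_pow M k)) (colon (E (ideal_pow M k.+1)) z).
Proof.
by move=> f Hf; rewrite /colon; apply: ext_polyM => //; apply: zgen_ext.
Qed.

Lemma colen_pow_colon k :
  L k.+1 = (colen P (idealD (E (ideal_pow M k.+1)) (principal z))
            + colen P (colon (E (ideal_pow M k.+1)) z))%N.
Proof. by rewrite -cM; apply: colen_colon. Qed.

Lemma hyperplane_colen_ge k :
  (L k.+1 <= colen P (idealD (E (ideal_pow M k.+1)) (principal z)) + L k)%N.
Proof.
rewrite colen_pow_colon leq_add2l -(cM k); apply: leq_colen => //.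
by apply: loc_subW => //; apply: pow_sub_colon.
Qed.

(** By superficiality [m^(k+1) : z] meets [m^c] inside [m^k], so its colength is at least
    [L k - L c]. What remains of [L k.+1] is an increment of [L] plus a constant. *)
Lemma hyperplane_colen_le : exists C, forall k,
  (colen P (idealD (E (ideal_pow M k)) (principal z)) <= eR * k + C)%N.
Proof.
have [c Hc] := zgen_superficial x NR; have [q Hq] := quadratic_increment Lpoly.
have small k : (colen P (idealD (E (ideal_pow M k)) (principal z)) <= L k)%N.
  by rewrite -(cM k); apply: leq_colen => //; apply: loc_subW => //; apply: idealD_subl.
pose N := maxn c n0.
(* [q] absorbs the error in the increment of [L], [L c] pays for intersecting with [m^c], and the
   sum covers the [k] up to [N], where nothing is asymptotic yet. *)
exists (q + L c + \sum_(i < N.+1) L i)%N => k.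
have [kN|] := leqP k N.
  apply: leq_trans (small k) _.
  have : (L k <= \sum_(i < N.+1) L i)%N.
    by rewrite (bigD1 (inord k)) //= inordK // leq_addr.
  by clear; lia.
case: k => // k; rewrite ltnS => Nk.
have [ck n0k] : (c <= k)%N /\ (n0 <= k)%N by move: Nk; rewrite /N; lia.
pose W := colon (E (ideal_pow M k.+1)) z.
have HW : is_ideal W by apply: colon_ideal.
have HI : is_ideal (idealI W (E (ideal_pow M c))) by apply: idealI_ideal.
(* An element of [m^c] climbs to [m^k] one power at a time, each step being an application of
   superficiality. *)
have WI : subsetR (idealI W (E (ideal_pow M c))) (E (ideal_pow M k)).
  move=> f [Wf]; suff H i : (c + i <= k)%N -> E (ideal_pow M c) f ->
      E (ideal_pow M (c + i)) f.
    by move=> Hf; have := H (k - c)%N; rewrite subnKC //; apply.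
  elim: i => [|i IH] Hi Hf; first by rewrite addn0.
  rewrite addnS; apply: Hc; first exact: leq_addr.
    by apply: IH => //; apply: leq_trans Hi; rewrite leq_add2l.
  move: Wf; apply: ext_poly_mono; apply: ideal_pow_sub => //.
  by move: Hi; clear; lia.
have FI : finite_colen P (idealI W (E (ideal_pow M c))).
  apply: finite_colen_sub (FM k) => //; apply: loc_subW => // f Hf; split.
    exact: pow_sub_colon.
  by move: Hf; apply: ext_poly_mono; apply: ideal_pow_sub.
have : (L k <= colen P W + L c)%N.
  rewrite -(cM c); apply: leq_trans (colen_idealI Eprime HW (HEk c) FI).
  by rewrite -(cM k); apply: leq_colen => //; apply: loc_subW.
have := colen_pow_colon k; have [+ _] := Hq k n0k; rewrite -/W.
set s := colen P (idealD _ _); set w := colen P W; set S := (\sum_(i < _) _)%N.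
by clear; lia.
Qed.

Variables (I : R -> Prop) (N : nat) (y : 'I_N -> R) (lI : nat).
Hypotheses (HI : is_ideal I) (Ifull : m_full x I) (Iy : eqsetR I (gen_ideal y)).
Hypothesis HlI : length_quot I lI.
Let FI : finite_colen P (E I).
Proof. by case: (length_quot_ext HI HlI). Qed.
Let cI : colen P (E I) = lI.
Proof. by case: (length_quot_ext HI HlI). Qed.
Let HEI : is_ideal (E I) := ext_poly_ideal n HI.
Let mI := ideal_mul M I.
Let HmI : is_ideal mI := ideal_mul_ideal HM HI.
Let HEmI : is_ideal (E mI) := ext_poly_ideal n HmI.

(** Each adjoined element is killed by [P] modulo [J], so it costs at most one unit of colength.
    Applied to generators of [I] over [mI], this bounds the length of [I/mI]. *)
Lemma colen_idealD_seq (J : {mpoly R[n]} -> Prop) (s : seq {mpoly R[n]}) :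
  is_ideal J -> finite_colen P J ->
  (forall u, u \in s -> forall p, P p -> J (u * p)) ->
  exists K, [/\ is_ideal K, subsetR J K, forall u, u \in s -> K u
    & (colen P J <= colen P K + size s)%N].
Proof.
elim: s J => [|u s IH] J HJ FJ Hs; first by exists J; split=> //; rewrite addn0.
have Hu := principal_ideal u; have HD := idealD_ideal HJ Hu.
have JD : subsetR J (idealD J (principal u)) by apply: idealD_subl.
have [|v vs p Pp|K [HK DK sK le_K]] := IH _ HD.
- by apply: finite_colen_sub FJ => //; apply: loc_subW.
- by apply: JD; apply: Hs => //; rewrite inE vs orbT.
exists K; split=> //; first by move=> p /JD; apply: DK.
  move=> v; rewrite inE => /orP[/eqP ->|]; last exact: sK.
  by apply: DK; apply: idealD_subr => //; exists 1; rewrite mul1r.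
rewrite /= addnS; apply: leq_trans (colen_idealD_principal Eprime (u := u) HJ FJ _) _ => //.
by move=> p Pp; apply: loc_memW => //; apply: Hs => //; rewrite inE eqxx.
Qed.

(** [I] contains [m^lI] locally, so [mI] contains [m^(lI+1)]. *)
Lemma finite_colen_mI : finite_colen P (E mI).
Proof.
have Hsub : loc_sub P (E (ideal_pow M lI)) (E I).
  apply: (loc_sub_trans Eprime (K := ideal_pow P lI)).
    by apply: loc_subW => //; apply: ext_poly_pow_sub.
  by apply: ideal_pow_loc_sub => // /(colen_geP Eprime FI); rewrite cI ltnn.
apply: (finite_colen_sub Eprime _ (FM lI.+1)); have HL' := loc_mem_ideal Eprime HEmI.
apply: ext_poly_sub => // c [k [d [f [Md [Hf ->]]]]].
rewrite rmorph_sum; apply: ideal_sum => // i _ /=; rewrite mpolyCM.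
have [s [Ps Hs]] := Hsub _ (ext_polyC (n:=n) (HMk lI) (Hf i)).
exists s; split=> //; rewrite mulrCA; apply: ext_polyM => //.
exact: ext_polyC.
Qed.

(** By m-fullness [mI : z] has the colength of [I], so the colength of [mI + z] is the length of
    [I/mI], at most the number of generators. *)
Lemma colen_mI_hyperplane : (colen P (idealD (E mI) (principal z)) <= N)%N.
Proof.
have FmI := finite_colen_mI.
have Ecol := colen_colon Eprime z HEmI FmI.
have EI : colen P (colon (E mI) z) = colen P (E I).
  apply: eq_colen => //.
  - move=> f Hf; have [H _] := Ifull f; apply: H.
    by apply: (@loc_memW _ P Eprime (E mI)).
  - move=> f If; have [_ H] := Ifull f; apply/loc_mem_colon; apply: H.
    exact: (@loc_memW _ P Eprime (E I)).
  - by apply: finite_colen_sub FmI => //; apply: loc_subW => //; apply: colon_sub.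
have [|K [HK mK sK]] := @colen_idealD_seq (E mI) [seq (y i)%:MP | i <- enum 'I_N] HEmI FmI.
  move=> _ /mapP[i _ ->] p Pp; rewrite mulrC; apply: ext_polyM => //.
  by apply: ext_polyC => //; apply/Iy; apply: gen_ideal_mem.
rewrite size_map size_enum_ord Ecol EI => le1.
have le2 : (colen P K <= colen P (E I))%N.
  apply: leq_colen => //; apply: loc_subW => //; apply: ext_poly_sub => // c.
  move=> /Iy [d ->]; rewrite rmorph_sum; apply: ideal_sum => // i _ /=.
  rewrite mpolyCM; apply: ideal_mull => //; apply: sK.
  by apply: map_f; rewrite mem_enum.
by move: le1 le2; lia.
Qed.

Lemma colen_I_hyperplane : (0 < eR)%N ->
  (colen P (idealD (E I) (principal z)) < N)%N.
Proof.
move=> eR0; apply: leq_trans colen_mI_hyperplane.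
have HD1 : is_ideal (idealD (E I) (principal z)) by apply: idealD_ideal.
have HD2 : is_ideal (idealD (E mI) (principal z)) by apply: idealD_ideal.
have mII : subsetR (E mI) (E I).
  apply: ext_poly_mono; apply: ideal_mul_sub => // c d _ Id; exact: ideal_mull.
apply: ltn_colen => //.
- by apply: loc_sub_idealD => //; apply: loc_subW.
- move=> Hno.
  (* If [I] lay in [mI + z], substituting this inclusion into itself would push [I] into [m^k + z]
     for every [k]. *)
  have step k : loc_sub P (E I) (idealD (E (ideal_pow M k)) (principal z)).
    elim: k => [|k IH]; first by apply: loc_subW => // p _; apply: idealD_subl.
    have HDk : is_ideal (idealD (E (ideal_pow M k.+1)) (principal z)) by apply: idealD_ideal.
    apply: (loc_sub_trans Eprime (K := idealD (E mI) (principal z))).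
      by move=> p Ip; apply: Hno; apply: idealD_subl.
    apply: idealD_loc_sub => //; last by apply: loc_subW => //; apply: idealD_subr.
    have HLk := loc_mem_ideal Eprime HDk.
    apply: ext_poly_sub => //.
    suff : subsetR mI (fun c => loc_mem P (idealD (E (ideal_pow M k.+1)) (principal z)) c%:MP) by [].
    apply: ideal_mul_sub.
      split; first by rewrite mpolyC0; apply: ideal0.
        by move=> c d Hc Hd; rewrite mpolyCD; apply: ideal_add.
      by move=> r c Hc; rewrite mpolyCM; apply: ideal_mull.
    move=> c d Mc Id; have [s [Ps [u [_ [Hu [w ->] Eu]]]]] := IH _ (ext_polyC (n:=n) HI Id).
    exists s; split=> //; exists (c%:MP * u), (c%:MP * w * z); split.
    + by apply: ext_polyM => //; apply: ext_polyC.
    + by eexists.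
    + by rewrite mpolyCM mulrCA Eu mulrDr mulrA.
  have [q Hq] := quadratic_increment Lpoly.
  (* Large enough that the growth [eR * k - q] of the colength of [m^(k+1) + z] exceeds the bound
     [lI] just obtained. *)
  pose k := (n0 + (lI + q).+1)%N.
  have [_ Hk] := Hq k (leq_addr _ _).
  have := hyperplane_colen_ge k.
  have : (colen P (idealD (E (ideal_pow M k.+1)) (principal z)) <= lI)%N.
    by rewrite -cI; apply: leq_colen.
  have : (k <= eR * k)%N by rewrite leq_pmull.
  have : (lI + q < k)%N by rewrite /k; clear; lia.
  move: Hk; set s := colen _ _; set ek := (eR * k)%N; move: s ek => s ek.
  by clear; lia.
- by apply: finite_colen_sub finite_colen_mI => //; apply: loc_subW => //; apply: idealD_subl.
Qed.

End MFull.

Lemma ex_least (Q : nat -> Prop) k : Q k ->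
  exists r, Q r /\ forall i, (i < r)%N -> ~ Q i.
Proof.
elim/ltn_ind: k => k IH Qk.
have [[i [ik Qi]]|Hno] := classic (exists i, (i < k)%N /\ Q i); first exact: IH Qi.
by exists k; split=> // i ik Qi; apply: Hno; exists i.
Qed.

Theorem theorem3p9 (R : comNzRingType) (n : nat) (x : 'I_n -> R)
  (I : R -> Prop) (N : nat) (y : 'I_N -> R) (eI eR lI : nat) :
  noetherian R ->
  local_with_max (gen_ideal x) ->
  krull_dim_eq R 2 ->
  primary_to (gen_ideal x) I ->
  m_full x I ->
  eqsetR I (gen_ideal y) ->
  (1 < N)%N ->
  multiplicity2 I eI ->
  multiplicity2 (gen_ideal x) eR ->
  length_quot I lI ->
  (eI%:R : rat) <= 2%:R * (1 - 1 / (2 * N - 2)%N%:R) * eR%:R * lI%:R.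
Proof.
move=> NR LR _ [[HI _] radI] Ifull Iy N1 [LI [a [b [n0 [HLI LIpoly]]]]]
  [L [a' [b' [n0' [HL Lpoly]]]]] HlI.
set M := gen_ideal x in LR radI HL.
have HM : is_ideal M := gen_ideal_ideal x.
have Mprime : is_prime M by apply: maximal_prime; case: LR.
pose E := @ext_poly R n; pose P := E M; pose z := zgen x.
have Eprime : is_prime P := ext_poly_prime n Mprime.
have HEI : is_ideal (E I) := ext_poly_ideal n HI.
have [FI cI] : finite_colen P (E I) /\ colen P (E I) = lI.
  exact: length_quot_ext.
(* Some power of [z] lies in [I] because [z] is in [P] and [P^lI] is locally inside [I]. *)
have [r [rP r_min]] : exists r, loc_mem P (E I) (z ^+ r) /\
    forall k, (k < r)%N -> ~ loc_mem P (E I) (z ^+ k).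
  apply: (ex_least (k := lI)); apply: (ideal_pow_loc_sub Eprime HEI (l := lI)).
    by move/(colen_geP Eprime FI); rewrite cI ltnn.
  by apply: ideal_powX; apply: zgen_ext.
have r0 : (0 < r)%N.
  rewrite lt0n; apply/eqP => r0; move: rP; rewrite r0 expr0 => -[s [Ps]].
  rewrite mulr1 => Is; apply: Ps => mo; apply/radI; exists 1%N; exact: Is.
have [C HC] := hyperplane_colen_le NR LR HL Lpoly.
have sC k : finite_colen P (E (ideal_pow M k)) /\
    (colen P (idealD (E (ideal_pow M k)) (principal z)) <= eR * k + C)%N.
  by split=> //; case: (length_quot_ext NR LR (ideal_pow_ideal k HM) (HL k)).
(* Comparison of the coefficients of the square of the exponent in the estimate for powers of [I].
   Starting at [n0.+1] keeps the exponent positive, so its predecessor is a true subtraction. *)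
have key : eI%:R + eR%:R * r%:R - 2 * eR%:R * lI%:R <= 0 :> rat.
  apply: (@quadratic_le0 _ (2 * C%:R * r%:R + eR%:R * r%:R - 2 * a) (- 2 * b) n0.+1).
  case=> // k nk.
  have [Fk ck] := length_quot_ext NR LR (ideal_pow_ideal k.+1 HI) (HLI k.+1).
  have := colen_ideal_pow Mprime HI FI rP r_min r0 sC Fk.
  rewrite ck cI /= -(ler_nat rat) !natrD !natrM (LIpoly k.+1 (ltnW nk)) -[k.+1%:R]natr1.
  lra.
have [eR0|eR0] := posnP eR.
  by move: key; rewrite eR0 mulr0 !mul0r mulr0 mul0r subr0 addr0.
have l0 := colen_I_hyperplane NR LR HL Lpoly HI Ifull Iy HlI eR0.
(* [lI] is a sum of [r] slices, each at most the slice at [0], whose colength is below [N]. *)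
have lIr : (lI <= r * N.-1)%N.
  rewrite -cI (colen_sum_slices Mprime HI FI rP).
  apply: (@leq_trans (\sum_(k < r) N.-1)); last by rewrite sum_nat_const card_ord.
  apply: leq_sum => k _; apply: leq_trans (slice_le0 Mprime HI FI k) _.
  rewrite -ltnS prednK ?(ltnW N1) //; apply: leq_ltn_trans l0.
  apply: leq_colen => //.
    apply: loc_subW => //; apply: idealD_sub.
    - exact: slice_ideal.
    - move=> p Ip; apply: idealD_subl; first exact: principal_ideal.
      by rewrite /colon expr0 mul1r.
    - by apply: idealD_subr; apply: colon_ideal.
  apply: finite_colen_sub FI => //; apply: loc_subW => //.
  by apply: idealD_subl; apply: principal_ideal.
have D0 : 0 < N.-1%:R :> rat by rewrite ltr0n; move: N1; lia.
have -> : (2 * N - 2 = 2 * N.-1)%N by lia.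
rewrite natrM; move: lIr key D0; rewrite -(ler_nat rat) natrM.
set D := N.-1%:R; set rr := r%:R; set l := lI%:R; set e := eR%:R => lIr key D0.
have e0 : 0 <= e by exact: ler0n.
(* With [D = N - 1] the target is [2 e l - e l / D], and [l / D <= r] reduces it to [key]. *)
have -> : 2 * (1 - 1 / (2 * D)) * e * l = 2 * e * l - e * (l / D).
  by field; rewrite gt_eqF.
have : e * (l / D) <= e * rr by rewrite ler_wpM2l // ler_pdivrMr.
by move: key; lra.
Qed.
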